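(* Suppose the homogeneous odds ratio model holds: there are $\beta_0\in\mathbb{R}$ and a real-valued measurable function $\eta$ with $$\operatorname{logit} P(Y=1\mid A,U,X)=\beta_0A+\eta(U,X)\quad\text{a.s.}$$ Suppose moreover that: (1) there is a positive-valued measurable function $\xi$ such that for $a=0,1$, a.s., $\dfrac{P(S=1\mid Y=1,A=a,U,X)}{P(S=1\mid Y=0,A=a,U,X)}=\xi(U,X)$; (2) $W\perp A\mid (U,X,Y,S)$ and $Z\perp (Y,W,S)\mid (A,U,X)$. Let $q(A,Z,X)$ and $h(A,W,X)$ be real-valued functions such that at least one of the following holds: (i) for $a=0,1$, almost surely, $E[q(A,Z,X)\mid A=a,U,X,Y=0,S=1]=1/P(A=a\mid U,X,Y=0,S=1)$; (ii) almost surely, $E\{h(A,W,X)\mid A,U,X,Y=0,S=1\}=\dfrac{P(Y=1\mid A,U,X,S=1)}{P(Y=0\mid A,U,X,S=1)}$. Let $c(X)$ be an arbitrary square-integrable real-valued function such that for $a=0,1$, $$\Theta_a:=E\Big\{c(X)\Big[I(A=a)q(A,Z,X)\{Y-(1-Y)h(a,W,X)\}+(1-Y)h(a,W,X)\Big]\,\Big|\, S=1\Big\}\neq 0 .$$ Then $$\beta_0=\log\left(\frac{E\big\{c(X)\big[I(A=1)q(A,Z,X)\{Y-(1-Y)h(A,W,X)\}+(1-Y)h(1,W,X)\big]\mid S=1\big\}}{E\big\{c(X)\big[I(A=0)q(A,Z,X)\{Y-(1-Y)h(A,W,X)\}+(1-Y)h(0,W,X)\big]\mid S=1\big\}}\r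ight).$$
   Context: $A$ (treatment), $Y$ (outcome), $S$ (selection indicator) are $\{0,1\}$-valued random variables; $X$ (measured covariates), $U$ (latent factors), $Z$ (treatment proxy), $W$ (outcome proxy) are random vectors, all on a common probability space. $\operatorname{logit}(p)=\log\{p/(1-p)\}$, $I(\cdot)$ is the indicator function, and $\perp$ denotes (conditional) independence. Conditioning on an event such as $Y=0,S=1$ together with random variables means conditional expectation under the law given that event. Standing conventions: positivity, i.e. $P(A=a,Y=y,S=1\mid U,X)>0$ a.s. for all $a,y\in\{0,1\}$, so that all displayed ratios are well defined; $q(A,Z,X)$, $(1-Y)h(a,W,X)$, and each of the variables $c(X)I(A=a)q(A,Z,X)Y$, $c(X)I(A=a)q(A,Z,X)(1-Y)h(a,W,X)$, $c(X)(1-Y)h(a,W,X)$ ($a=0,1$) are integrable given $S=1$. *)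

(* Defs.v *)
From HB Require Import structures.
From mathcomp Require Export all_boot all_order all_algebra.
From mathcomp Require Export all_classical all_reals all_analysis.

Set Implicit Arguments.
Unset Strict Implicit.
Unset Printing Implicit Defensive.

Export Order.TTheory GRing.Theory Num.Theory.
Export numFieldNormedType.Exports.

Local Open Scope classical_set_scope.
Local Open Scope ring_scope.

(* The law P( . | E) = P( . `&` E) / P E. It is total in E: when E is not
   measurable or P E = 0 its value is P, by convention. *)
Definition cond_law d (T : measurableType d) (R : realType)
    (P : probability T R) (E : set T) : probability T R :=
  match pselect (measurable E) with
  | left mE => [the probability T R of mnormalize (mrestr P mE) P]
  | right _ => P
  end.

(* f is a version of the conditional expectation of V given the sigma-algebra
   generated by G, under the law Q. *)
Definition is_cond_exp d d' (T : measurableType d) (T' : measurableType d')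
    (R : realType) (Q : probability T R) (G : T -> T') (V f : T -> R) : Prop :=
  [/\ Q.-integrable setT (EFin \o V),
      Q.-integrable setT (EFin \o f),
      measurable_fun setT (f : g_sigma_algebra_preimageType G -> R) &
      forall B : set T, g_sigma_algebra_preimage G B ->
        (\int[Q]_(w in B) (f w)%:E = \int[Q]_(w in B) (V w)%:E)%E].

(* A chosen version of E_Q[V | G]. Versions are equal up to a Q-null set of the
   sigma-algebra generated by G, so statements that hold almost surely do not
   depend on the choice. The value is 0 when V is not Q-integrable. *)
Definition cond_exp d d' (T : measurableType d) (T' : measurableType d')
    (R : realType) (Q : probability T R) (G : T -> T') (V : T -> R) : T -> R :=
  xget (cst 0) [set f | is_cond_exp Q G V f].

Definition cond_prob d d' (T : measurableType d) (T' : measurableType d')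
    (R : realType) (Q : probability T R) (G : T -> T') (E : set T) : T -> R :=
  cond_exp Q G (\1_E : T -> R).

Definition cond_indep d d1 d2 d' (T : measurableType d)
    (T1 : measurableType d1) (T2 : measurableType d2) (T' : measurableType d')
    (R : realType) (Q : probability T R)
    (V1 : T -> T1) (V2 : T -> T2) (G : T -> T') : Prop :=
  forall (B : set T1) (C : set T2), measurable B -> measurable C ->
    {ae Q, forall w, cond_prob Q G (V1 @^-1` B `&` V2 @^-1` C) w =
      cond_prob Q G (V1 @^-1` B) w * cond_prob Q G (V2 @^-1` C) w}.

Definition logit (R : realType) (p : R) : R := ln (p / (1 - p)).

(* Main.v *)
(* Conditional expectations are compared without choosing versions: f and g are
   related along H when they have the same integral over every event of
   sigma(H), which is E[f | H] = E[g | H]. This relation may be multiplied by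
   any sigma(H)-measurable factor, as long as one side stays integrable.

   Write V = (U, X) and r_a = xi e^(beta0 a + eta). The odds ratio model and the
   selection assumption give 1{A=a, Y=1, S=1} ~ 1{A=a, Y=0, S=1} r_a(V) along V.
   Under either bridge assumption the integrand of Theta_a, restricted to S = 1,
   is related to 1{Y=0, S=1} c(X) r_a(V).

   (i) Since Z is independent of (Y, W, S) given (A, V), q may be replaced by
   1 / pi_a(V) on {A=a, S=1}, with pi_a = P(A=a | V, Y=0, S=1). The Y part becomes
   c r_a on {Y=0, S=1}, and by the independence of W and A the two terms in h
   cancel.

   (ii) The ratio in the bridge equation is r_A(V), and by the independence of W
   and A, h(a, W, X) averages to r_a(V) on the whole of {Y=0, S=1}. Hence
   Y - (1-Y) h(a, W, X) averages to 0 given (A, V) on {A=a, S=1}, and by the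
   independence of Z it still does after multiplication by q.

   Finally r_1 = e^beta0 r_0. *)
Require Import Defs.
From HB Require Import structures.
From mathcomp Require Import ring lra.
From mathcomp Require Import measurable_realfun.

Set Implicit Arguments.
Unset Strict Implicit.
Unset Printing Implicit Defensive.

Local Open Scope classical_set_scope.
Local Open Scope ring_scope.

(** * Integrability of real-valued functions *)

Section real_integrable.
Context d (T : measurableType d) (R : realType).
Variable P : {measure set T -> \bar R}.
Implicit Types f g : T -> R.

Lemma integrable_le f g : P.-integrable setT (EFin \o g) ->
  measurable_fun setT f -> (forall w, `|f w| <= `|g w|) ->
  P.-integrable setT (EFin \o f).
Proof.
move=> ig mf fg; apply: le_integrable ig => //; first exact/measurable_EFinP.
by move=> w _; rewrite lee_fin.
Qed.

Lemma integrable_ext f g : P.-integrable setT (EFin \o g) ->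
  (forall w, f w = g w) -> P.-integrable setT (EFin \o f).
Proof. by move=> ig fg; rewrite (_ : f = g) //; apply/funext. Qed.

Lemma integrable_measurable f : P.-integrable setT (EFin \o f) ->
  measurable_fun setT f.
Proof. by move=> /integrableP[/measurable_EFinP]. Qed.

Lemma integrable_add f g : P.-integrable setT (EFin \o f) ->
  P.-integrable setT (EFin \o g) ->
  P.-integrable setT (EFin \o (fun w => f w + g w)).
Proof. by move=> fi gi; exact: (integrableD measurableT fi gi). Qed.

Lemma integral_add f g : P.-integrable setT (EFin \o f) ->
  P.-integrable setT (EFin \o g) ->
  (\int[P]_w (f w + g w)%:E = \int[P]_w (f w)%:E + \int[P]_w (g w)%:E)%E.
Proof. by move=> fi gi; exact: (integralD_EFin measurableT fi gi). Qed.

End real_integrable.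

(** * Equality of conditional expectations *)

Section same_cexp.
Context d d' (T : measurableType d) (T' : measurableType d') (R : realType).
Variable P : {measure set T -> \bar R}.
Variables (H : T -> T').
Hypothesis mH : measurable_fun setT H.
Import HBNNSimple.

Let mpre B : measurable B -> measurable (H @^-1` B).
Proof. by move=> mB; rewrite -[X in measurable X]setTI; exact: mH. Qed.

Lemma integral_nnsfun_weight (mu : {measure set T -> \bar R}) (s : {nnsfun T' >-> R}) (f : T -> R) :
  measurable_fun setT f -> (forall w, 0 <= f w) ->
  (\int[mu]_w (s (H w) * f w)%:E =
   \sum_(y \in range s) y%:E * \int[mu]_(w in H @^-1` (s @^-1` [set y])) (f w)%:E)%E.
Proof.
move=> mf f0.
transitivity (\int[mu]_w (\sum_(y \in range s)
    (y * \1_(s @^-1` [set y]) (H w) * f w)%:E))%E.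
  apply: eq_integral => w _.
  rewrite fsumEFin // {1}(fimfunE s (H w)).
  by rewrite !fsbig_finite //= mulr_suml.
have mi y : measurable_fun setT
    (fun w => \1_(s @^-1` [set y]) (H w) : R).
  exact: (@measurableT_comp _ _ _ _ _ _ (\1_(s @^-1` [set y]) : T' -> R)).
rewrite ge0_integral_fsum //; last 2 first.
- move=> y; apply/measurable_EFinP; apply: measurable_funM => //.
  by apply: measurable_funM.
- move=> y w _; rewrite lee_fin mulr_ge0 //.
  exact: (nnfun_muleindic_ge0 s y (H w)).
apply: eq_fsbigr => y /[!inE] -[t _ <-].
under eq_integral do rewrite -mulrA EFinM.
rewrite ge0_integralZl_EFin //; last 2 first.
- by move=> w _; rewrite lee_fin mulr_ge0.
- by apply/measurable_EFinP; apply: measurable_funM.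
congr (_ * _)%E.
rewrite [RHS]integral_mkcond; apply: eq_integral => w _.
rewrite epatch_indic /= EFinM muleC; congr (_ * _)%E.
Qed.

(** The inequality passes from events to nonnegative simple functions of [H] by linearity, then to
    [g] by monotone convergence. Two measures are allowed so that, with [H] the identity,
    integration against a density is covered too. *)
Lemma ge0_le_integral_weight (P' : {measure set T -> \bar R})
    (f f' : T -> R) (g : T' -> R) :
  measurable_fun setT f -> (forall w, 0 <= f w) ->
  measurable_fun setT f' -> (forall w, 0 <= f' w) ->
  measurable_fun setT g -> (forall t, 0 <= g t) ->
  (forall B, measurable B ->
    \int[P]_(w in H @^-1` B) (f w)%:E <= \int[P']_(w in H @^-1` B) (f' w)%:E)%E ->
  (\int[P]_w (g (H w) * f w)%:E <= \int[P']_w (g (H w) * f' w)%:E)%E.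
Proof.
move=> mf f0 mf' f'0 mg g0 ff'.
have mge : measurable_fun setT (EFin \o g) by exact/measurable_EFinP.
pose s := nnsfun_approx measurableT mge.
have E (mu : {measure set T -> \bar R}) (k : T -> R) :
    measurable_fun setT k -> (forall w, 0 <= k w) ->
    (fun n => \int[mu]_w (s n (H w) * k w)%:E)%E @ \oo -->
      (\int[mu]_w (g (H w) * k w)%:E)%E.
  move=> mk k0.
  have -> : (\int[mu]_w (g (H w) * k w)%:E =
      \int[mu]_w (limn (fun n => (s n (H w) * k w)%:E)))%E.
    apply: eq_integral => w _; apply/esym/cvg_lim => //.
    under eq_fun do rewrite EFinM.
    rewrite EFinM; apply: cvgeZr => //.
    by apply: (@cvg_nnsfun_approx _ _ _ _ measurableT _ mge) => //= x _; rewrite lee_fin.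
  apply: cvg_monotone_convergence => //.
  - move=> n; apply/measurable_EFinP; apply: measurable_funM => //.
    exact: measurableT_comp.
  - by move=> n w _; rewrite lee_fin mulr_ge0.
  - move=> w _ m n mn; rewrite lee_fin ler_wpM2r //.
    exact/lefP/nd_nnsfun_approx.
have cf := E P _ mf f0; have cf' := E P' _ mf' f'0.
rewrite -(cvg_lim _ cf) // -(cvg_lim _ cf') //.
apply: lee_lim; [by apply/cvg_ex; eexists; exact: cf | by apply/cvg_ex; eexists; exact: cf'|].
apply: nearW => n; rewrite !integral_nnsfun_weight //.
rewrite !fsbig_finite //= !big_seq.
apply: lee_sum => y; rewrite in_fset_set // inE => -[t _ <-].
apply: lee_wpmul2l; first by rewrite lee_fin.
by apply: ff'; exact: measurable_funPTI.
Qed.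
(* E[f | H] = E[g | H] almost surely, for integrable f and g. *)
Definition same_cexp (f g : T -> R) : Prop :=
  [/\ P.-integrable setT (EFin \o f), P.-integrable setT (EFin \o g) &
      forall B, measurable B ->
        (\int[P]_(w in H @^-1` B) (f w)%:E = \int[P]_(w in H @^-1` B) (g w)%:E)%E].

Implicit Types f g : T -> R.

Lemma same_cexp_sym f g : same_cexp f g -> same_cexp g f.
Proof. by move=> [fi gi fg]; split => // B mB; rewrite fg. Qed.

Lemma same_cexp_trans g f f' : same_cexp f g -> same_cexp g f' -> same_cexp f f'.
Proof. by move=> [fi gi fg] [_ hi gh]; split => // B mB; rewrite fg // gh. Qed.

Lemma same_cexp_ae f g : P.-integrable setT (EFin \o f) ->
  measurable_fun setT g -> {ae P, forall w, f w = g w} -> same_cexp f g.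
Proof.
move=> fi mg fg; have mf := integrable_measurable fi.
have fg' : ae_eq P setT (EFin \o f) (EFin \o g).
  by move: fg; apply: filterS => w /= + _ => ->.
have gi : P.-integrable setT (EFin \o g).
  apply/integrableP; split; first exact/measurable_EFinP.
  suff <- : (\int[P]_x `|(EFin \o f) x| = \int[P]_x `|(EFin \o g) x|)%E.
    by case/integrableP: fi.
  apply: ae_eq_integral => //.
  - by apply: measurableT_comp => //; exact/measurable_EFinP.
  - by apply: measurableT_comp => //; exact/measurable_EFinP.
  - by move: fg; apply: filterS => w /= + _ => ->.
split => // B mB; apply: ae_eq_integral => //.
- exact: mpre.
- by apply: measurable_funTS; exact/measurable_EFinP.
- by apply: measurable_funTS; exact/measurable_EFinP.
- by move: fg; apply: filterS => w /= + _ => ->.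
Qed.

Lemma integral_preimage_indic B (f : T -> R) : measurable B ->
  (\int[P]_(w in H @^-1` B) (f w)%:E = \int[P]_w (\1_B (H w) * f w)%:E)%E.
Proof.
move=> mB; rewrite integral_mkcond; apply: eq_integral => w _.
by rewrite epatch_indic /= EFinM muleC.
Qed.

(** Monotone approximation needs nonnegative functions. Adding [u = |f| + |g|] makes both [f] and
    [g] nonnegative, and the signed weight [k] is the difference of [k + |k|] and [|k|]. *)
Lemma same_cexp_weight_integral (k : T' -> R) (f g : T -> R) :
  measurable_fun setT k -> same_cexp f g ->
  P.-integrable setT (EFin \o (fun w => k (H w) * f w)) ->
  P.-integrable setT (EFin \o (fun w => k (H w) * g w)) ->
  (\int[P]_w (k (H w) * f w)%:E = \int[P]_w (k (H w) * g w)%:E)%E.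
Proof.
move=> mk [fi gi fg] kfi kgi.
have mf := integrable_measurable fi; have mg := integrable_measurable gi.
pose u := fun w => `|f w| + `|g w|.
have ge0 (x : R) : 0 <= x + `|x| by have := ler_norm (- x); rewrite normrN; lra.
pose F := fun w => f w + u w; pose G := fun w => g w + u w.
have mu : measurable_fun setT u.
  by apply: measurable_funD; exact: measurableT_comp.
have mF : measurable_fun setT F by apply: measurable_funD.
have mG : measurable_fun setT G by apply: measurable_funD.
have F0 w : 0 <= F w.
  by rewrite /F /u addrA addr_ge0.
have G0 w : 0 <= G w.
  by rewrite /G /u addrCA addr_ge0.
have ui : P.-integrable setT (EFin \o u) by apply: integrable_add; exact: integrable_norm.
have Fi : P.-integrable setT (EFin \o F) by exact: integrable_add.
have Gi : P.-integrable setT (EFin \o G) by exact: integrable_add.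
have FG B : measurable B ->
    (\int[P]_(w in H @^-1` B) (F w)%:E = \int[P]_(w in H @^-1` B) (G w)%:E)%E.
  move=> mB; have mHB := mpre mB.
  have S k' : P.-integrable setT (EFin \o k') ->
    P.-integrable (H @^-1` B) (EFin \o k') by apply: integrableS.
  have h1 := integralD_EFin mHB (S _ fi) (S _ ui).
  have h2 := integralD_EFin mHB (S _ gi) (S _ ui).
  by rewrite [LHS]h1 [RHS]h2; congr (_ + _)%E; exact: fg.
pose k1 := fun t => k t + `|k t|; pose k2 := fun t => `|k t|.
have mk2 : measurable_fun setT k2 by exact: measurableT_comp.
have mk1 : measurable_fun setT k1 by apply: measurable_funD.
have k10 t : 0 <= k1 t by rewrite /k1 ge0.
have k20 t : 0 <= k2 t by exact: normr_ge0.
have kui : P.-integrable setT (EFin \o (fun w => `|k (H w)| * u w)).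
  apply: (integrable_ext (integrable_add (integrable_norm kfi) (integrable_norm kgi))).
  by move=> w /=; rewrite /u mulrDr !normrM.
(* All auxiliary products are dominated by [4 |k(H)| u], and [|k(H)| u] is the sum of [|k(H) f|] and
   [|k(H) g|]. *)
have kk (k' : T' -> R) (f' : T -> R) : measurable_fun setT k' -> measurable_fun setT f' ->
    (forall t, `|k' t| <= `|k t| + `|k t|) -> (forall w, `|f' w| <= u w + u w) ->
    P.-integrable setT (EFin \o (fun w => k' (H w) * f' w)).
  move=> mk' mf' lk lf.
  apply: (integrable_le (integrable_add (integrable_add kui kui) (integrable_add kui kui))).
    by apply: measurable_funM => //; exact: measurableT_comp.
  move=> w; rewrite normrM; apply: le_trans (ler_pM _ _ (lk _) (lf w)) _ => //.
  by rewrite mulrDl !mulrDr ler_norm.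
have lF w : `|F w| <= u w + u w.
  by rewrite ger0_norm // /F lerD2r (le_trans (ler_norm _)) // /u lerDl.
have lG w : `|G w| <= u w + u w.
  by rewrite ger0_norm // /G lerD2r (le_trans (ler_norm _)) // /u lerDr.
have l1 t : `|k1 t| <= `|k t| + `|k t|.
  by rewrite ger0_norm // /k1 lerD2r ler_norm.
have l2 t : `|k2 t| <= `|k t| + `|k t| by rewrite normr_id lerDl.
have E (k' : T' -> R) : measurable_fun setT k' -> (forall t, 0 <= k' t) ->
    (\int[P]_w (k' (H w) * F w)%:E = \int[P]_w (k' (H w) * G w)%:E)%E.
  move=> mk' k'0; apply/eqP; rewrite eq_le; apply/andP; split.
  - by apply: ge0_le_integral_weight => // B mB; rewrite FG.
  - by apply: ge0_le_integral_weight => // B mB; rewrite FG.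
have Z (a b c : T -> R) : P.-integrable setT (EFin \o a) ->
    P.-integrable setT (EFin \o b) -> P.-integrable setT (EFin \o c) ->
    (\int[P]_w (a w + (b w + c w))%:E =
     \int[P]_w (a w)%:E + (\int[P]_w (b w)%:E + \int[P]_w (c w)%:E))%E.
  move=> ai bi ci; rewrite -(integral_add bi ci) -integral_add //.
  exact: integrable_add.
have i1F := kk _ _ mk1 mF l1 lF; have i2F := kk _ _ mk2 mF l2 lF.
have i1G := kk _ _ mk1 mG l1 lG; have i2G := kk _ _ mk2 mG l2 lG.
(* Since [k = k1 - k2] and [f - g = F - G], the difference [k f - k g] expands into four products,
   moved here to the sides where they are added. By [E] their integrals agree, and being finite they
   cancel. *)
have : (\int[P]_w (k (H w) * f w + (k1 (H w) * G w + k2 (H w) * F w))%:E =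
        \int[P]_w (k (H w) * g w + (k1 (H w) * F w + k2 (H w) * G w))%:E)%E.
  by apply: eq_integral => w _; congr _%:E; rewrite /k1 /k2 /F /G; ring.
rewrite !Z // (E k1) // (E k2) //.
have fin (a : T -> R) : P.-integrable setT (EFin \o a) ->
    (\int[P]_w (a w)%:E)%E \is a fin_num by exact: integrable_fin_num.
move=> /(congr1 (fun x => x - (\int[P]_w (k1 (H w) * G w)%:E +
    \int[P]_w (k2 (H w) * G w)%:E))%E).
by rewrite !addeK // fin_numD; apply/andP; split; exact: fin.
Qed.

End same_cexp.

Lemma measurable_sgr d (T : measurableType d) (R : realType) (m : T -> R) :
  measurable_fun setT m -> measurable_fun setT (fun t => Num.sg (m t)).
Proof.
move=> mm; rewrite (_ : (fun t => _) =
    (fun t => (if m t < 0 then -1 else if 0 < m t then 1 else 0))).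
  by do 2 (apply: measurable_fun_ifT => //; first exact: measurable_fun_ltr).
by apply/funext => t; case: sgrP.
Qed.

Lemma normr_sg_le1 (R : realDomainType) (x : R) : `|Num.sg x| <= 1.
Proof. by case: sgrP => _; rewrite ?normr0 ?normr1 ?normrN1. Qed.

(** * Pulling out known factors, and uniqueness *)

Section pull_out.
Context d d' (T : measurableType d) (T' : measurableType d') (R : realType).
Variable P : {measure set T -> \bar R}.
Variables (H : T -> T').
Hypothesis mH : measurable_fun setT H.
Implicit Types f g : T -> R.

Lemma measurable_preimage B : measurable B -> measurable (H @^-1` B).
Proof. by move=> mB; rewrite -[X in measurable X]setTI; exact: mH. Qed.

Lemma same_cexp_weight (k : T' -> R) f g : measurable_fun setT k ->
  same_cexp P H f g ->
  P.-integrable setT (EFin \o (fun w => k (H w) * f w)) ->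
  P.-integrable setT (EFin \o (fun w => k (H w) * g w)) ->
  same_cexp P H (fun w => k (H w) * f w) (fun w => k (H w) * g w).
Proof.
move=> mk fg kfi kgi; split => // B mB.
rewrite !(integral_preimage_indic P) //.
have m1 : measurable_fun setT (fun t => \1_B t * k t).
  by apply: measurable_funM => //; exact: measurable_indic.
have E (f' : T -> R) : P.-integrable setT (EFin \o (fun w => k (H w) * f' w)) ->
    P.-integrable setT (EFin \o (fun w => (\1_B (H w) * k (H w)) * f' w)).
  move=> i'; apply: (integrable_le i').
    rewrite (_ : (fun w => _) = (fun w => \1_B (H w) * (k (H w) * f' w))).
      apply: measurable_funM; last exact: integrable_measurable i'.
      by apply: (@measurableT_comp _ _ _ _ _ _ (\1_B : T' -> R)) => //; exact: measurable_indic.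
    by apply/funext => w; rewrite mulrA.
  move=> w; rewrite -mulrA normrM ler_piMl // indicE.
  by case: (_ \in _); rewrite ?normr1 ?normr0.
under eq_integral do rewrite mulrA.
under [RHS]eq_integral do rewrite mulrA.
by apply: (same_cexp_weight_integral mH m1 fg); exact: E.
Qed.

(* Testing against the sign of [m] turns the signed identity into
   [E[D |m(H)|; H in B] <= E[|f|; H in B]]. *)
Lemma same_cexp_weight_integrable (k m : T' -> R) (D f : T -> R) :
  measurable_fun setT k -> measurable_fun setT m -> (forall w, 0 <= D w) ->
  same_cexp P H f (fun w => D w * m (H w)) ->
  P.-integrable setT (EFin \o (fun w => k (H w) * f w)) ->
  P.-integrable setT (EFin \o (fun w => k (H w) * (D w * m (H w)))).
Proof.
move=> mk mm D0 fm kfi; have [fi gi _] := fm.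
have mf := integrable_measurable fi; have mg := integrable_measurable gi.
have msg := measurable_sgr mm.
have sg1 t : `|Num.sg (m t)| <= 1 by exact: normr_sg_le1.
have msH : measurable_fun setT (fun w => Num.sg (m (H w))).
  exact: (@measurableT_comp _ _ _ _ _ _ (fun t => Num.sg (m t))).
have E (f' : T -> R) : P.-integrable setT (EFin \o f') ->
    P.-integrable setT (EFin \o (fun w => Num.sg (m (H w)) * f' w)).
  move=> i'; apply: (integrable_le i').
    by apply: measurable_funM => //; exact: integrable_measurable i'.
  by move=> w; rewrite normrM ler_piMl.
have [_ _ sE] := same_cexp_weight msg fm (E _ fi) (E _ gi).
have le B : measurable B -> (\int[P]_(w in H @^-1` B) (`|D w * m (H w)|)%:E <=
    \int[P]_(w in H @^-1` B) (`|f w|)%:E)%E.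
  move=> mB; have mHB := measurable_preimage mB.
  have -> : (\int[P]_(w in H @^-1` B) (`|D w * m (H w)|)%:E =
      \int[P]_(w in H @^-1` B) (Num.sg (m (H w)) * f w)%:E)%E.
    rewrite sE //; apply: eq_integral => w _; congr _%:E.
    by rewrite normrM (ger0_norm (D0 w)) mulrCA (normrEsg (m (H w))).
  have S k' : P.-integrable setT (EFin \o k') ->
    P.-integrable (H @^-1` B) (EFin \o k') by apply: integrableS.
  apply: (@le_integral _ _ _ P _ mHB).
  - exact: S (E _ fi).
  - exact: S (integrable_norm fi).
  - move=> w _ /=; rewrite lee_fin (le_trans (ler_norm _)) // normrM.
    by rewrite ler_piMl.
have mkH : measurable_fun setT (fun w => k (H w)) by exact: measurableT_comp.
apply/integrableP; split.
  by apply/measurable_EFinP; apply: measurable_funM.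
apply: (@le_lt_trans _ _ (\int[P]_w (`|k (H w)| * `|f w|)%:E)%E); last first.
  case/integrableP: kfi => _; apply: le_lt_trans.
  by under eq_integral do rewrite -normrM.
under eq_integral do rewrite /= normrM.
(* The bound on events extends to the weight [|k|]: the integral of [|k(H)| D |m(H)|] is at most
   that of [|k(H) f|], which is finite. *)
apply: (ge0_le_integral_weight mH (g := fun t => `|k t|));
  try exact: le; try by move=> *; exact: normr_ge0.
- by apply: measurableT_comp.
- by apply: measurableT_comp.
- by apply: measurableT_comp.
Qed.

(** Integrability is asked of [f'] only. That of [g'] follows from the shape of [g]: a nonnegative
    [D], in practice an event indicator, times a function of [H]. *)
Lemma same_cexp_pull (k m : T' -> R) (D f g f' g' : T -> R) :
  same_cexp P H f g ->
  measurable_fun setT k -> measurable_fun setT m -> (forall w, 0 <= D w) ->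
  (forall w, g w = D w * m (H w)) ->
  (forall w, f' w = k (H w) * f w) -> (forall w, g' w = k (H w) * g w) ->
  P.-integrable setT (EFin \o f') -> same_cexp P H f' g'.
Proof.
move=> fg mk mm D0 /funext gE /funext f'E /funext g'E f'i; subst.
apply: same_cexp_weight => //.
apply: (same_cexp_weight_integrable (D := D) (f := f)) => //.
Qed.

Lemma same_cexp_pull_bounded (k : T' -> R) (f g f' g' : T -> R) :
  same_cexp P H f g ->
  measurable_fun setT k -> (forall t, `|k t| <= 1) ->
  (forall w, f' w = k (H w) * f w) -> (forall w, g' w = k (H w) * g w) ->
  same_cexp P H f' g'.
Proof.
move=> fg mk k1 /funext f'E /funext g'E; subst; have [fi gi _] := fg.
have E (h : T -> R) : P.-integrable setT (EFin \o h) ->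
    P.-integrable setT (EFin \o (fun w => k (H w) * h w)).
  move=> hi; apply: (integrable_le hi).
    apply: measurable_funM; last exact: integrable_measurable hi.
    exact: measurableT_comp.
  by move=> w; rewrite normrM ler_piMl.
by apply: same_cexp_weight => //; exact: E.
Qed.

(** After multiplication by the sign of [m - m'], the two integrals over the whole space differ by
    the integral of [D |m(H) - m'(H)|], which must therefore vanish. *)
Lemma same_cexp_uniq (m m' : T' -> R) (D : T -> R) :
  measurable_fun setT m -> measurable_fun setT m' -> (forall w, 0 <= D w) ->
  same_cexp P H (fun w => D w * m (H w)) (fun w => D w * m' (H w)) ->
  {ae P, forall w, D w * m (H w) = D w * m' (H w)}.
Proof.
move=> mm mm' D0 fg; have [fi gi _] := fg.
have mn : measurable_fun setT (fun t => m t - m' t) by exact: measurable_funB.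
have [kfi kgi kE] := same_cexp_pull_bounded fg (measurable_sgr mn)
  (fun t => normr_sg_le1 (m t - m' t)) (fun=> erefl) (fun=> erefl).
have := kE _ measurableT; rewrite preimage_setT => kE'.
have e0 : (\int[P]_w `|(D w * m (H w) - D w * m' (H w))%:E| = 0)%E.
  transitivity (\int[P]_w ((Num.sg (m (H w) - m' (H w)) * (D w * m (H w)))%:E -
      (Num.sg (m (H w) - m' (H w)) * (D w * m' (H w)))%:E))%E.
    apply: eq_integral => w _ /=; rewrite -EFinB; congr _%:E.
    rewrite -[RHS]mulrBr -!mulrBr normrM ger0_norm // [RHS]mulrCA.
    by congr (_ * _); exact: normrEsg.
  rewrite integralB_EFin // kE' subee //; exact: integrable_fin_num.
have mf := integrable_measurable fi; have mg := integrable_measurable gi.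
have me : measurable_fun setT (EFin \o (fun w => D w * m (H w) - D w * m' (H w))).
  by apply/measurable_EFinP; apply: measurable_funB.
move/(ae_eq_integral_abs P measurableT me): e0; apply: filterS => w /= /(_ I) [] /eqP.
by rewrite subr_eq0 => /eqP.
Qed.

(** The tower property: composing with [k] coarsens the sigma-algebra. *)
Lemma same_cexp_comp d2 (T2 : measurableType d2) (k : T' -> T2) f g :
  measurable_fun setT k -> same_cexp P H f g -> same_cexp P (k \o H) f g.
Proof.
move=> mk [fi gi fg]; split => // B mB; rewrite comp_preimage; apply: fg.
by rewrite -[X in measurable X]setTI; exact: mk.
Qed.

End pull_out.


(** * Existence of conditional expectations *)

Section existence.
Local Open Scope charge_scope.
Context d d' (T : measurableType d) (T' : measurableType d') (R : realType).
Variable P : probability T R.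
Variables (H : T -> T').
Hypothesis mH : measurable_fun setT H.
Implicit Types f g : T -> R.

(** [m] is the Radon-Nikodym derivative of the pushforward along [H] of the signed measure [f dP]
    with respect to the law of [H]. Differentiating on [T'] yields the conditional expectation
    directly as a function of [H]. *)
Lemma same_cexp_exists f : P.-integrable setT (EFin \o f) ->
  exists2 m : T' -> R, measurable_fun setT m & same_cexp P H f (m \o H).
Proof.
move=> fi.
pose nu : {charge set T' -> \bar R} :=
  measure_function_pushforward__canonical__charge_Charge (induced_charge fi) mH.
pose X : {mfun T >-> T'} := HB.pack H (isMeasurableFun.Build _ _ _ _ H mH).
pose mu : probability T' R := distribution P X.
have numu : nu `<< mu.
  apply/null_content_dominatesP => A mA A0.
  apply: null_set_integral => //; first exact: measurable_preimage.
  by apply: measurable_funTS; exact: measurable_int fi.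
pose m := 'd nu '/d mu.
have mfin t : m t \is a fin_num by exact: Radon_Nikodym_fin_num.
have mi : mu.-integrable setT m by exact: Radon_Nikodym_integrable.
have mm : measurable_fun setT (fine \o m).
  by apply: measurableT_comp => //; exact: measurable_int mi.
have mE t : (fine (m t))%:E = m t by rewrite fineK.
have mHE : EFin \o (fun w => fine (m (H w))) = m \o H.
  by apply/funext => w; exact: mE.
have mHi : P.-integrable setT (EFin \o (fun w => fine (m (H w)))).
  apply/integrableP; split.
    by apply/measurable_EFinP; exact: (@measurableT_comp _ _ _ _ _ _ (fine \o m)).
  have /integrableP[mm' ] := mi; apply: le_lt_trans.
  rewrite (ge0_integral_pushforward mH P (D := setT) (f := fun t => `|m t|%E)) //=.
  - rewrite preimage_setT (eq_integral (fun w => `|m (H w)|%E)) // => w _.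
    by rewrite -(mE (H w)).
  - exact: measurableT_comp.
exists (fine \o m) => //; split => // B mB.
transitivity (nu B) => //.
rewrite (Radon_Nikodym_integral numu mB).
rewrite (integral_pushforward mH (mu := P) (f := m)) //.
- by apply: eq_integral => w _ /=; rewrite mE.
- exact: measurable_int mi.
- apply: (integrableS measurableT) => //; first exact: measurable_preimage.
  by rewrite -mHE.
Qed.
End existence.

(** * Measures with a density and product sigma-algebras *)

Section density.
Context d (T : measurableType d) (R : realType).
Variables (P Q : {measure set T -> \bar R}) (rho : T -> R).
Hypotheses (mrho : measurable_fun setT rho) (rho0 : forall w, 0 <= rho w).
Hypothesis Qrho : forall B, measurable B -> Q B = (\int[P]_(w in B) (rho w)%:E)%E.

(** The constant 1 under [Q] and [rho] under [P] have equal integrals over every event; [f] enters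
    as the weight, with the identity in place of [H]. *)
Lemma ge0_integral_density (f : T -> R) :
  measurable_fun setT f -> (forall w, 0 <= f w) ->
  (\int[Q]_w (f w)%:E = \int[P]_w (rho w * f w)%:E)%E.
Proof.
move=> mf f0; have mid : measurable_fun setT (@id T) by [].
have E B : measurable B -> (\int[Q]_(w in id @^-1` B) (cst 1 w : R)%:E =
    \int[P]_(w in id @^-1` B) (rho w)%:E)%E.
  by move=> mB; rewrite preimage_id -Qrho // -[RHS]mul1e -integral_cst.
transitivity (\int[Q]_w (f w * 1)%:E)%E.
  by under [RHS]eq_integral do rewrite mulr1.
under [RHS]eq_integral do rewrite mulrC.
apply/eqP; rewrite eq_le; apply/andP; split.
- apply: (ge0_le_integral_weight mid (g := f) (f := cst 1)) => // B mB.
  by rewrite E.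
- apply: (ge0_le_integral_weight mid (g := f) (f' := cst 1)) => // B mB.
  by rewrite E.
Qed.

Lemma integrable_density (f : T -> R) : measurable_fun setT f ->
  Q.-integrable setT (EFin \o f) <->
  P.-integrable setT (EFin \o (fun w => rho w * f w)).
Proof.
move=> mf; have mrf : measurable_fun setT (fun w => rho w * f w).
  exact: measurable_funM.
have E : (\int[Q]_w `|(f w)%:E| = \int[P]_w `|(rho w * f w)%:E|)%E.
  rewrite /= ge0_integral_density //; last exact: measurableT_comp.
  by apply: eq_integral => w _; rewrite normrM (ger0_norm (rho0 w)).
split=> /integrableP[_ foo]; apply/integrableP; split; try exact/measurable_EFinP.
- by rewrite -E.
- by move: foo; rewrite -E.
Qed.

Lemma integral_density (f : T -> R) D : measurable D -> measurable_fun setT f ->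
  (\int[Q]_(w in D) (f w)%:E = \int[P]_(w in D) (rho w * f w)%:E)%E.
Proof.
move=> mD mf.
have mk (k : T -> R) : measurable_fun setT k -> measurable_fun setT (fun w => \1_D w * k w).
  by move=> mk'; apply: measurable_funM => //; exact: measurable_indic.
have M (mu : {measure set T -> \bar R}) (k : T -> R) :
    (\int[mu]_(w in D) (k w)%:E = \int[mu]_w (\1_D w * k w)%:E)%E.
  rewrite integral_mkcond; apply: eq_integral => w _.
  by rewrite epatch_indic /= EFinM muleC.
have mg := mk _ mf; set g := (fun w => \1_D w * f w) in mg.
rewrite !M -/g; transitivity (\int[P]_w (rho w * g w)%:E)%E; last first.
  by apply: eq_integral => w _; rewrite /g mulrCA.
(* Multiplication by [rho >= 0] commutes with positive and negative parts, to which the nonnegative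
   case applies. *)
rewrite integralE [RHS]integralE; congr (_ - _)%E.
- have -> : (fun w => (g w)%:E)^\+%E = EFin \o g^\+%R by rewrite -funerpos.
  have -> : (fun w => (rho w * g w)%:E)^\+%E = EFin \o (fun w => rho w * g w)^\+%R.
    by rewrite -funerpos.
  rewrite ge0_integral_density //; last exact: measurable_funrpos.
  by apply: eq_integral => w _; rewrite /= /funrpos maxr_pMr ?mulr0.
- have -> : (fun w => (g w)%:E)^\-%E = EFin \o g^\-%R by rewrite -funerneg.
  have -> : (fun w => (rho w * g w)%:E)^\-%E = EFin \o (fun w => rho w * g w)^\-%R.
    by rewrite -funerneg.
  rewrite ge0_integral_density //; last exact: measurable_funrneg.
  by apply: eq_integral => w _; rewrite /= /funrneg maxr_pMr ?mulr0 // mulrN.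
Qed.

End density.

Section rectangles.
Context d d1 d' (T : measurableType d) (T1 : measurableType d1)
  (T' : measurableType d') (R : realType).
Variable P : {measure set T -> \bar R}.
Variables (V : T -> T1) (G : T -> T').
Hypotheses (mV : measurable_fun setT V) (mG : measurable_fun setT G).

(** Rectangles form a pi-system generating the product sigma-algebra, and the sets with equal
    integrals form a Dynkin system: finiteness of the integrals allows subtraction for complements,
    countable additivity handles disjoint unions. *)
Lemma same_cexp_rectangles (f g : T -> R) :
  P.-integrable setT (EFin \o f) -> P.-integrable setT (EFin \o g) ->
  (forall B B', measurable B -> measurable B' ->
    (\int[P]_(w in V @^-1` B `&` G @^-1` B') (f w)%:E =
     \int[P]_(w in V @^-1` B `&` G @^-1` B') (g w)%:E)%E) ->
  same_cexp P (fun w => (V w, G w)) f g.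
Proof.
move=> fi gi fg; split => //.
have mVG : measurable_fun setT (fun w => (V w, G w)) by exact: measurable_fun_pair.
have fgT : (\int[P]_w (f w)%:E = \int[P]_w (g w)%:E)%E.
  by have := fg _ _ measurableT measurableT; rewrite !preimage_setT setTI.
move=> S; rewrite measurable_prod_measurableType; move: S.
apply: dynkin_induction.
- exact: measurable_prod_measurableType.
- move=> _ _ [A1 mA1 [B1 mB1 <-]] [A2 mA2 [B2 mB2 <-]].
  exists (A1 `&` A2); first exact: measurableI.
  by exists (B1 `&` B2); [exact: measurableI|rewrite setXI].
- by rewrite preimage_setT.
- by move=> _ [A mA [B mB <-]]; exact: fg.
- move=> S mS; have mHS := measurable_preimage mVG mS.
  rewrite -preimage_setC => e.
  have E (k : T -> R) : P.-integrable setT (EFin \o k) ->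
      (\int[P]_(w in ~` ((fun w => (V w, G w)) @^-1` S)) (k w)%:E =
       \int[P]_w (k w)%:E - \int[P]_(w in (fun w => (V w, G w)) @^-1` S) (k w)%:E)%E.
    move=> ki; rewrite -[in X in (X - _)%E](setvU ((fun w => (V w, G w)) @^-1` S)).
    rewrite integral_setU //.
    + rewrite addeK //; apply: integrable_fin_num => //.
      exact: integrableS ki.
    + exact: measurableC.
    + by apply: measurable_funTS; case/integrableP: ki.
    + by rewrite disj_set2E setICl.
  by rewrite !E // fgT e.
- move=> F mF tF e; rewrite preimage_bigcup.
  have mHF n := measurable_preimage mVG (mF n).
  have tH : trivIset setT (fun n => (fun w => (V w, G w)) @^-1` F n).
    apply/trivIsetP => i j _ _ ij; rewrite -preimage_setI.
    by move/trivIsetP : tF => /(_ _ _ I I ij) ->; rewrite preimage_set0.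
  rewrite !integral_bigcup //; last 2 first.
  + by apply: integrableS gi => //; exact: bigcup_measurable.
  + by apply: integrableS fi => //; exact: bigcup_measurable.
  by apply: eq_eseriesr => n _; exact: e.
Qed.
End rectangles.

(** * Versions under a conditional law *)

Section events.
Context d (T : measurableType d) (R : realType).
Variable P : probability T R.
Implicit Types b : T -> bool.

Lemma bool_indicE b w : (b w)%:R = \1_[set w | b w] w :> R.
Proof.
rewrite indicE; case: (boolP (b w)) => bw; first by rewrite mem_set.
by rewrite memNset // => /(negP bw).
Qed.

Lemma measurable_bool_natr b : measurable [set w | b w] ->
  measurable_fun setT (fun w => (b w)%:R : R).
Proof.
by move=> mb; rewrite (funext (bool_indicE b)); exact: measurable_indic.
Qed.

Lemma integral_bool b D : measurable [set w | b w] -> measurable D ->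
  (\int[P]_(w in D) ((b w)%:R)%:E = P (D `&` [set w | b w]))%E.
Proof.
move=> mb mD; under eq_integral do rewrite bool_indicE.
by rewrite integral_indic // setIC.
Qed.

Lemma integrable_bool b : measurable [set w | b w] ->
  P.-integrable setT (EFin \o (fun w => (b w)%:R : R)).
Proof.
move=> mb; rewrite (funext (bool_indicE b)); exact: integrable_indic.
Qed.

End events.

Section versions.
Context d d' (T : measurableType d) (T' : measurableType d') (R : realType).
Variables (P : probability T R) (G : T -> T').
Hypothesis mG : measurable_fun setT G.

(** The chosen version is compared with a version [m] that is a function of [G]. The exceptional set
    is given as an event of sigma([G]), the form in which its nullity can be carried from a
    conditional law over to [P]. *)
Lemma cond_exp_version (f : T -> R) : P.-integrable setT (EFin \o f) ->
  exists m : T' -> R, [/\ measurable_fun setT m, same_cexp P G f (m \o G) &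
    exists2 B, measurable B & P (G @^-1` B) = 0%E /\
      forall w, ~ B (G w) -> cond_exp P G f w = m (G w)].
Proof.
move=> fi; have [m mm fm] := same_cexp_exists mG fi.
exists m; split => //; have [_ mi fmE] := fm.
pose Tg := g_sigma_algebra_preimageType G.
have msub B : g_sigma_algebra_preimage G B -> measurable B.
  by move=> [C mC <-]; rewrite setTI; exact: measurable_preimage.
(* Reading sigma([G]) as generated by the identity into [Tg] makes both versions functions of the
   conditioning variable, so uniqueness applies with [D = 1]. *)
have mid : measurable_fun setT (id : T -> Tg).
  by move=> _ B mB; rewrite setTI preimage_id; exact: msub.
have mmG : measurable_fun setT (fun w : Tg => m (G w)).
  move=> _ B mB; rewrite setTI; exists (m @^-1` B); last by rewrite setTI.
  by rewrite -[X in measurable X]setTI; exact: mm.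
have ex : is_cond_exp P G f (m \o G).
  split => // B [C mC <-]; rewrite setTI; apply/esym; exact: fmE.
have [_ vi mv vE] : is_cond_exp P G f (cond_exp P G f).
  exact: (xgetI (P := [set f' | is_cond_exp P G f f']) (cst 0) ex).
set v := cond_exp P G f in vi mv vE *.
have vm : same_cexp P (id : T -> Tg) (fun w => 1 * v w) (fun w => 1 * m (G w)).
  split.
  - by apply: (integrable_ext vi) => w; rewrite mul1r.
  - by apply: (integrable_ext mi) => w; rewrite mul1r.
  - move=> B mB; rewrite preimage_id.
    under eq_integral do rewrite mul1r.
    under [RHS]eq_integral do rewrite mul1r.
    by rewrite vE //; case: mB => C mC <-; rewrite setTI fmE.
have ae := same_cexp_uniq mid mv mmG (fun=> ler01) vm.
have [B mB BE] : g_sigma_algebra_preimage G [set w | v w != m (G w)].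
  have := @measurable_neqe _ Tg R setT measurableT (EFin \o v) (EFin \o (m \o G)).
  by rewrite setTI; apply; exact/measurable_EFinP.
exists B => //; rewrite setTI in BE; rewrite BE; split.
  case: ae => N [mN N0 sN]; apply: (subset_measure0 _ mN _ N0) => //.
    by rewrite -BE; exact: measurable_preimage.
  by move=> w /= neq; apply: sN => /=; rewrite !mul1r; exact/eqP.
move=> w nB; apply/eqP; apply: contrapT => /negP neq.
by apply: nB; have : [set w | v w != m (G w)] w by []; rewrite -BE.
Qed.

End versions.

Section conditional_law.
Context d (T : measurableType d) (R : realType).
Variables (P : probability T R) (b : T -> bool).
Hypothesis mb : measurable [set w | b w].
Let E := [set w | b w].
Hypothesis PE : P E != 0%E.

Let rho (w : T) : R := (fine (P E))^-1 * (b w)%:R.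

Let PEfin : P E \is a fin_num. Proof. exact: fin_num_measure. Qed.

Let PE0 : 0 < fine (P E).
Proof. by apply: fine_gt0; rewrite lt0e PE measure_ge0 /= ltey_eq PEfin. Qed.

Let mrho : measurable_fun setT rho.
Proof. by apply: measurable_funM => //; exact: measurable_bool_natr. Qed.

Let rho0 w : 0 <= rho w.
Proof. by rewrite mulr_ge0 // invr_ge0 ltW. Qed.

Lemma cond_lawE B : cond_law P E B = (P (B `&` E) * (fine (P E))^-1%:E)%E.
Proof.
rewrite /cond_law; case: pselect => // mE /=.
rewrite /mnormalize /= /mrestr setTI (negbTE PE) /=.
by case: eqP => // Poo; move: PEfin; rewrite Poo.
Qed.

Let cond_law_density B : measurable B ->
  cond_law P E B = (\int[P]_(w in B) (rho w)%:E)%E.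
Proof.
move=> mB; rewrite cond_lawE; under eq_integral do rewrite /rho EFinM.
rewrite ge0_integralZl_EFin //.
- by rewrite integral_bool // muleC.
- by apply: measurable_funTS; apply/measurable_EFinP; exact: measurable_bool_natr.
- by rewrite invr_ge0 ltW.
Qed.

Let fine_rho w x : fine (P E) * (rho w * x) = (b w)%:R * x.
Proof. by rewrite /rho -mulrA mulVKf // gt_eqF. Qed.

Lemma integrable_cond_law (f : T -> R) : measurable_fun setT f ->
  (cond_law P E).-integrable setT (EFin \o f) <->
  P.-integrable setT (EFin \o (fun w => (b w)%:R * f w)).
Proof.
move=> mf; rewrite (integrable_density mrho rho0 cond_law_density mf); split=> h.
- apply: (integrable_ext (integrableZl measurableT (fine (P E)) h)) => w /=.
  by rewrite fine_rho.
- apply: (integrable_ext (integrableZl measurableT (fine (P E))^-1 h)) => w /=.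
  by rewrite /rho mulrA.
Qed.

Lemma integral_cond_law (f : T -> R) : measurable_fun setT f ->
  P.-integrable setT (EFin \o (fun w => (b w)%:R * f w)) ->
  fine (\int[cond_law P E]_w (f w)%:E)%E =
    (fine (P E))^-1 * fine (\int[P]_w ((b w)%:R * f w)%:E)%E.
Proof.
move=> mf fi.
rewrite (integral_density mrho rho0 cond_law_density measurableT mf).
under eq_integral do rewrite /rho -mulrA EFinM.
rewrite integralZl // fineM //; exact: integrable_fin_num.
Qed.

(** This brings relations under different conditional laws to the single law [P]. The density is
    cleared by multiplying by [P E], a constant bounded by 1. *)
Lemma same_cexp_cond_law d' (T' : measurableType d') (G : T -> T') (f g : T -> R) :
  measurable_fun setT G -> measurable_fun setT f -> measurable_fun setT g ->
  same_cexp (cond_law P E) G f g ->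
  same_cexp P G (fun w => (b w)%:R * f w) (fun w => (b w)%:R * g w).
Proof.
move=> mG mf mg [fi gi fg].
have fgr : same_cexp P G (fun w => rho w * f w) (fun w => rho w * g w).
  split.
  - by apply/(integrable_density mrho rho0 cond_law_density mf).
  - by apply/(integrable_density mrho rho0 cond_law_density mg).
  - move=> B mB; have mGB := measurable_preimage mG mB.
    by rewrite -!(integral_density mrho rho0 cond_law_density) ?fg.
apply: (same_cexp_pull_bounded mG fgr (k := cst (fine (P E)))) => //.
- move=> t; rewrite /cst ger0_norm; last exact: ltW.
  by have := probability_le1 P mb; rewrite -/E -(fineK PEfin) lee_fin.
Qed.

End conditional_law.

(** * Events of positive conditional probability *)

Section charged.
Context d d' (T : measurableType d) (T' : measurableType d') (R : realType).
Variables (P : probability T R) (G : T -> T').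
Hypothesis mG : measurable_fun setT G.

(* P(E | G) > 0 almost surely. *)
Definition charged (E : set T) : Prop := forall B, measurable B ->
  P (E `&` G @^-1` B) = 0%E -> P (G @^-1` B) = 0%E.

Lemma charged_neq0 E : charged E -> P E != 0%E.
Proof.
move=> cE; apply/eqP => PE0; have := cE _ measurableT.
rewrite preimage_setT setIT => /(_ PE0); rewrite probability_setT.
by move/eqP; rewrite onee_eq0.
Qed.

Lemma charged_sub E F : measurable E -> measurable F -> E `<=` F ->
  charged E -> charged F.
Proof.
move=> mE mF EF cE B mB F0; apply: cE => //.
have mGB := measurable_preimage mG mB.
apply: subset_measure0 F0; [exact: measurableI|exact: measurableI|].
exact: setSI.
Qed.

(** The disagreement of [m] and [m'] is an event of sigma([G]) that meets the charged event in a
    null set, hence it is null. *)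
Lemma charged_ae_eq (b : T -> bool) (m m' : T' -> R) :
  measurable [set w | b w] -> measurable_fun setT m ->
  measurable_fun setT m' -> charged [set w | b w] ->
  {ae P, forall w, (b w)%:R * m (G w) = (b w)%:R * m' (G w)} ->
  {ae P, forall w, m (G w) = m' (G w)}.
Proof.
move=> mb mm mm' cb [N [mN N0 sN]].
have mB : measurable [set t | m t != m' t].
  have := @measurable_neqe _ T' R setT measurableT (EFin \o m) (EFin \o m').
  by rewrite setTI; apply; exact/measurable_EFinP.
have mGB := measurable_preimage mG mB.
exists (G @^-1` [set t | m t != m' t]); split => //; last by move=> w /= /eqP.
apply: cb => //; apply: (subset_measure0 _ mN _ N0) => //; first exact: measurableI.
move=> w [/= bw /eqP neq]; apply: sN => /=; rewrite bw !mul1r //.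
Qed.

(** [m] is the probability of [b'] given [G] within [b]. Over the event [m(G) <= 0] the right side
    integrates to a nonpositive number and the left side to a probability; so [b && b'] is null
    there, and being charged it forces the event to be null. *)
Lemma charged_gt0 (b b' : T -> bool) (m : T' -> R) :
  measurable [set w | b w && b' w] -> measurable_fun setT m ->
  charged [set w | b w && b' w] ->
  same_cexp P G (fun w => (b w && b' w)%:R) (fun w => (b w)%:R * m (G w)) ->
  {ae P, forall w, 0 < m (G w)}.
Proof.
move=> mb mm cb [_ _ E].
pose B := [set t | m t <= 0].
have mB : measurable B.
  have := @measurable_lee _ T' R setT measurableT (EFin \o m) (EFin \o cst 0).
  by rewrite setTI /B; apply; exact/measurable_EFinP.
have mGB := measurable_preimage mG mB.
exists (G @^-1` B); split => //; last first.
  by move=> w /= /negP; rewrite -leNgt.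
apply: cb => //; rewrite setIC -integral_bool // E //.
apply/eqP; rewrite eq_le; apply/andP; split.
  have -> : (\int[P]_(w in G @^-1` B) ((b w)%:R * m (G w))%:E =
      - \int[P]_(w in G @^-1` B) (- ((b w)%:R * m (G w)))%:E)%E.
    rewrite -integral_ge0N.
      by apply: eq_integral => w _; rewrite EFinN oppeK.
    by move=> w /= m0; rewrite lee_fin oppr_ge0 mulr_ge0_le0.
  rewrite oppe_le0; apply: integral_ge0 => w /= m0.
  by rewrite lee_fin oppr_ge0 mulr_ge0_le0.
by rewrite -E // integral_bool // measure_ge0.
Qed.

(** The exceptional set of the version lies in sigma([G]) and is null given [b]. As [b] is charged,
    it is null under [P], which gives the almost sure equality under [P]. *)
Lemma cond_exp_cond_law (b : T -> bool) (f : T -> R) :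
  measurable [set w | b w] -> measurable_fun setT f ->
  P.-integrable setT (EFin \o (fun w => (b w)%:R * f w)) ->
  charged [set w | b w] ->
  exists m : T' -> R, [/\ measurable_fun setT m,
    same_cexp P G (fun w => (b w)%:R * f w) (fun w => (b w)%:R * m (G w)) &
    {ae P, forall w, cond_exp (cond_law P [set w | b w]) G f w = m (G w)}].
Proof.
move=> mb mf fi cb; have P0 := charged_neq0 cb.
have fQ : (cond_law P [set w | b w]).-integrable setT (EFin \o f).
  exact/integrable_cond_law.
have [m [mm fm [B mB [B0 vE]]]] := cond_exp_version mG fQ.
exists m; split => //.
  apply: same_cexp_cond_law => //; exact: measurableT_comp.
have PB0 : P (G @^-1` B) = 0%E.
  apply: cb => //; move/eqP: B0; rewrite cond_lawE // mule_eq0 => /orP[/eqP|].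
    by rewrite setIC.
  rewrite eqe invr_eq0 fine_eq0 ?(negbTE P0) //; exact: fin_num_measure.
exists (G @^-1` B); split => //; first exact: measurable_preimage.
by move=> w /= neq; apply: contrapT => nB; apply: neq; exact: vE.
Qed.

Lemma cond_exp_ae (f : T -> R) : P.-integrable setT (EFin \o f) ->
  exists m : T' -> R, [/\ measurable_fun setT m, same_cexp P G f (m \o G) &
    {ae P, forall w, cond_exp P G f w = m (G w)}].
Proof.
move=> fi; have [m [mm fm [B mB [B0 vE]]]] := cond_exp_version mG fi.
exists m; split => //; exists (G @^-1` B); split => //.
  exact: measurable_preimage.
by move=> w /= neq; apply: contrapT => nB; apply: neq; exact: vE.
Qed.

End charged.

(** * Conditional independence *)

Section pairs.
Context d d1 d' (T : measurableType d) (T1 : measurableType d1)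
  (T' : measurableType d') (R : realType).
Variables (P : probability T R).

(** Rectangles suffice, and the integral over a rectangle is one over an event of sigma([G]) once
    the indicator in [V] is moved into the integrand. *)
Lemma same_cexp_pair (V : T -> T1) (G : T -> T') (f g : T -> R) :
  measurable_fun setT V -> measurable_fun setT G ->
  (forall B, measurable B -> same_cexp P G (fun w => \1_B (V w) * f w)
                                           (fun w => \1_B (V w) * g w)) ->
  same_cexp P (fun w => (V w, G w)) f g.
Proof.
move=> mV mG fg; have [fi gi _] := fg _ measurableT.
have i1 (k : T -> R) : P.-integrable setT (EFin \o (fun w => \1_setT (V w) * k w)) ->
    P.-integrable setT (EFin \o k).
  by move=> ki; apply: (integrable_ext ki) => w; rewrite indicT mul1r.
apply: same_cexp_rectangles => //; try exact: i1.
move=> B B' mB mB'; have [_ _ E] := fg _ mB; have := E _ mB'.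
have H (k : T -> R) : (\int[P]_(w in V @^-1` B `&` G @^-1` B') (k w)%:E =
    \int[P]_(w in G @^-1` B') (\1_B (V w) * k w)%:E)%E.
  rewrite setIC integral_mkcondr; apply: eq_integral => w _.
  by rewrite epatch_indic /= EFinM muleC.
by rewrite !H.
Qed.

Lemma same_cexp_snd (V : T -> T1) (G : T -> T') (f g : T -> R) :
  same_cexp P (fun w => (V w, G w)) f g -> same_cexp P G f g.
Proof. by move=> /(same_cexp_comp (measurable_snd)). Qed.

Lemma measurable_indic_comp (V : T -> T1) B : measurable_fun setT V ->
  measurable B -> measurable_fun setT (fun w => \1_B (V w) : R).
Proof.
move=> mV mB; exact: (@measurableT_comp _ _ _ _ _ _ (\1_B : T1 -> R)).
Qed.

Lemma normr_indic_le1 (B : set T1) t : `|\1_B t : R| <= 1.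
Proof. by rewrite indicE; case: (_ \in _); rewrite ?normr1 ?normr0. Qed.

Lemma integrable_indicM (V : T -> T1) B (f : T -> R) : measurable_fun setT V ->
  measurable B -> P.-integrable setT (EFin \o f) ->
  P.-integrable setT (EFin \o (fun w => \1_B (V w) * f w)).
Proof.
move=> mV mB fi; apply: (integrable_le fi).
  apply: measurable_funM; last exact: integrable_measurable fi.
  exact: measurable_indic_comp.
by move=> w; rewrite normrM ler_piMl // normr_indic_le1.
Qed.

Lemma same_cexp_exists_on (D : T -> bool) (G : T -> T') (f : T -> R) :
  measurable_fun setT G -> measurable [set w | D w] -> P [set w | D w] != 0%E ->
  measurable_fun setT f -> P.-integrable setT (EFin \o (fun w => (D w)%:R * f w)) ->
  exists2 m : T' -> R, measurable_fun setT m &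
    same_cexp P G (fun w => (D w)%:R * f w) (fun w => (D w)%:R * m (G w)).
Proof.
move=> mG mD PD mf fi.
have fQ : (cond_law P [set w | D w]).-integrable setT (EFin \o f).
  exact/integrable_cond_law.
have [m mm fm] := same_cexp_exists mG fQ; exists m => //.
by apply: same_cexp_cond_law => //; exact: measurableT_comp.
Qed.

End pairs.

Section conditional_independence.
Context d d1 d2 d' (T : measurableType d) (T1 : measurableType d1)
  (T2 : measurableType d2) (T' : measurableType d') (R : realType).
Variable P : probability T R.

(** A one-sided form of conditional independence on [D]: given [(V2, G)], the probability that [V1]
    is in [B] is a function of [G] alone. Functions of [(V2, G)] can be multiplied into this
    relation. *)
Definition cond_indep_on (D : T -> bool) (V1 : T -> T1) (V2 : T -> T2) (G : T -> T') :=
  forall B, measurable B -> exists2 k : T' -> R, measurable_fun setT k &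
    same_cexp P (fun w => (V2 w, G w)) (fun w => (D w)%:R * \1_B (V1 w))
      (fun w => (D w)%:R * k (G w)).

Lemma cond_indep_on_restrict (D : T2 * T' -> bool) (V1 : T -> T1) (V2 : T -> T2) (G : T -> T') :
  measurable_fun setT V2 -> measurable_fun setT G ->
  measurable [set p | D p] ->
  cond_indep_on xpredT V1 V2 G -> cond_indep_on (fun w => D (V2 w, G w)) V1 V2 G.
Proof.
move=> mV2 mG mD VG B mB; have [k mk E] := VG B mB; exists k => //.
apply: (same_cexp_pull_bounded (measurable_fun_pair mV2 mG) E
  (k := fun p => (D p)%:R)).
- exact: measurable_bool_natr.
- by move=> p; case: (D p); rewrite ?normr1 ?normr0.
- by move=> w; rewrite mul1r.
- by move=> w; rewrite mul1r.
Qed.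

(** On [D], the average given [G] of a function of [(V2, G)] stays its average when [V1] is also
    known. For a test event in [V1], its indicator is replaced by [k(G)], then [f] by [D m(G)], and
    finally [k(G)] is turned back into the indicator. *)
Lemma cond_indep_on_integrable (D : T -> bool) (V1 : T -> T1) (V2 : T -> T2) (G : T -> T')
    (phi : T2 * T' -> R) (m : T' -> R) (f : T -> R) :
  measurable_fun setT V1 -> measurable_fun setT V2 -> measurable_fun setT G ->
  measurable [set w | D w] ->
  measurable_fun setT phi -> measurable_fun setT m ->
  (forall w, (D w)%:R * phi (V2 w, G w) = f w) ->
  cond_indep_on D V1 V2 G ->
  same_cexp P G f (fun w => (D w)%:R * m (G w)) ->
  same_cexp P (fun w => (V1 w, G w)) f (fun w => (D w)%:R * m (G w)).
Proof.
move=> mV1 mV2 mG mD mphi mm /funext <-{f} VG fm.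
have [fi mi _] := fm.
apply: same_cexp_pair => // B mB; have [k mk kE] := VG B mB.
have mV2G := measurable_fun_pair mV2 mG.
have D0 w : 0 <= (D w)%:R :> R by [].
have s1 : same_cexp P (fun w => (V2 w, G w))
    (fun w => \1_B (V1 w) * ((D w)%:R * phi (V2 w, G w)))
    (fun w => k (G w) * ((D w)%:R * phi (V2 w, G w))).
  apply: (same_cexp_pull mV2G kE mphi (m := k \o snd) (D := fun w => (D w)%:R)) => //.
  - exact: measurableT_comp.
  - by move=> w; ring.
  - by move=> w; ring.
  - exact: integrable_indicM.
have kE' := same_cexp_snd kE.
have [_ kfi _] := s1.
have s2 : same_cexp P G (fun w => k (G w) * ((D w)%:R * phi (V2 w, G w)))
    (fun w => k (G w) * ((D w)%:R * m (G w))).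
  exact: (same_cexp_pull mG fm mk mm (D := fun w => (D w)%:R)).
have s3 : same_cexp P G (fun w => \1_B (V1 w) * ((D w)%:R * m (G w)))
    (fun w => k (G w) * ((D w)%:R * m (G w))).
  apply: (same_cexp_pull mG kE' mm mk (D := fun w => (D w)%:R)) => //.
  - by move=> w; ring.
  - by move=> w; ring.
  - exact: integrable_indicM.
apply: same_cexp_trans (same_cexp_snd s1) _.
by apply: same_cexp_trans s2 (same_cexp_sym s3).
Qed.

(** With [k] and [l] the probabilities of the two events given [G], the product formula makes the
    joint indicator average to [k l]; so does [k] times the second indicator. Letting the second
    event vary gives the relation along [(V2, G)]. *)
Lemma cond_indep_cond_indep_on (V1 : T -> T1) (V2 : T -> T2) (G : T -> T') :
  measurable_fun setT V1 -> measurable_fun setT V2 -> measurable_fun setT G ->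
  cond_indep P V1 V2 G -> cond_indep_on xpredT V1 V2 G.
Proof.
move=> mV1 mV2 mG ind B mB.
have iI (F : set T) : measurable F -> P.-integrable setT (EFin \o (\1_F : T -> R)).
  by move=> mF; exact: integrable_indic.
have mV1B := measurable_preimage mV1 mB.
have [k [mk Bk Bae]] := cond_exp_ae mG (iI _ mV1B).
exists k => //; have [_ ki _] := Bk.
have one (f : T -> R) : (fun w => (xpredT w)%:R * f w) = f.
  by apply/funext => w; rewrite mul1r.
rewrite !one; apply: same_cexp_pair => // C mC.
have mV2C := measurable_preimage mV2 mC.
have [l [ml Cl Cae]] := cond_exp_ae mG (iI _ mV2C).
have [n [mn BCn BCae]] := cond_exp_ae mG (iI _ (measurableI _ _ mV1B mV2C)).
have nkl : {ae P, forall w, n (G w) = k (G w) * l (G w)}.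
  have BCkl : {ae P, forall w, cond_prob P G (V1 @^-1` B `&` V2 @^-1` C) w =
      k (G w) * l (G w)}.
    by move: Bae Cae (ind _ _ mB mC); apply: filterS3 => w /= <- <-.
  by move: BCae BCkl; apply: filterS2 => w /= <- <-.
have s1 : same_cexp P G (fun w => k (G w) * \1_C (V2 w)) (fun w => k (G w) * l (G w)).
  apply: (same_cexp_pull mG Cl mk ml (D := cst 1)) => //.
  - by move=> w; rewrite mul1r.
  - by apply: (integrable_ext (integrable_indicM mV2 mC ki)) => w; rewrite mulrC.
have s2 : same_cexp P G (n \o G) (fun w => k (G w) * l (G w)).
  have [_ ni _] := BCn; have [_ kli _] := s1.
  by apply: same_cexp_ae => //; exact: integrable_measurable kli.
rewrite (_ : (fun w => \1_C (V2 w) * \1_B (V1 w)) = \1_(V1 @^-1` B `&` V2 @^-1` C)); last first.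
  by apply/funext => w; rewrite indicI mulrC.
apply: same_cexp_trans BCn _; apply: same_cexp_trans s2 _.
by under [X in same_cexp _ _ _ X]eq_fun do rewrite mulrC; exact: same_cexp_sym.
Qed.

End conditional_independence.

Lemma cond_indep_on_sym d d1 d2 d' (T : measurableType d)
    (T1 : measurableType d1) (T2 : measurableType d2) (T' : measurableType d')
    (R : realType) (P : probability T R) (D : T -> bool)
    (V1 : T -> T1) (V2 : T -> T2) (G : T -> T') :
  measurable_fun setT V1 -> measurable_fun setT V2 -> measurable_fun setT G ->
  measurable [set w | D w] -> P [set w | D w] != 0%E ->
  cond_indep_on P D V1 V2 G -> cond_indep_on P D V2 V1 G.
Proof.
move=> mV1 mV2 mG mD PD VG B mB.
have mB2 : measurable_fun setT (fun w => \1_B (V2 w) : R).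
  exact: measurable_indic_comp.
have iB : P.-integrable setT (EFin \o (fun w => (D w)%:R * \1_B (V2 w))).
  apply: (integrable_ext (integrable_indicM mV2 mB (integrable_bool P mD))) => w.
  exact: mulrC.
have [m mm Bm] := same_cexp_exists_on mG mD PD mB2 iB; exists m => //.
apply: (cond_indep_on_integrable (phi := fun p => \1_B p.1) mV1 mV2 mG mD _ mm) VG Bm => //.
exact: (measurable_indic_comp measurable_fst mB).
Qed.

Lemma cond_indep_sym d d1 d2 d' (T : measurableType d) (T1 : measurableType d1)
    (T2 : measurableType d2) (T' : measurableType d') (R : realType)
    (P : probability T R) (V1 : T -> T1) (V2 : T -> T2) (G : T -> T') :
  cond_indep P V1 V2 G -> cond_indep P V2 V1 G.
Proof.
move=> ind B C mB mC; move: (ind _ _ mC mB); apply: filterS => w /=.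
by rewrite setIC mulrC.
Qed.

Section linear.
Context d d' (T : measurableType d) (T' : measurableType d') (R : realType).
Variables (P : {measure set T -> \bar R}) (H : T -> T').
Hypothesis mH : measurable_fun setT H.

Lemma same_cexp_refl (f : T -> R) : P.-integrable setT (EFin \o f) -> same_cexp P H f f.
Proof. by move=> fi; split. Qed.

Lemma same_cexp_eq (f g f' g' : T -> R) : same_cexp P H f g ->
  (forall w, f' w = f w) -> (forall w, g' w = g w) -> same_cexp P H f' g'.
Proof. by move=> fg /funext -> /funext ->. Qed.

Lemma same_cexpD (f g f' g' : T -> R) : same_cexp P H f g -> same_cexp P H f' g' ->
  same_cexp P H (fun w => f w + f' w) (fun w => g w + g' w).
Proof.
move=> [fi gi fg] [fi' gi' fg']; split; try exact: integrable_add.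
move=> B mB; have mHB := measurable_preimage mH mB.
have S k : P.-integrable setT (EFin \o k) ->
  P.-integrable (H @^-1` B) (EFin \o k) by apply: integrableS.
under eq_integral do rewrite EFinD.
under [RHS]eq_integral do rewrite EFinD.
by rewrite !integralD_EFin // ?fg ?fg' //; exact: S.
Qed.

Lemma same_cexpB (f g f' g' : T -> R) : same_cexp P H f g -> same_cexp P H f' g' ->
  same_cexp P H (fun w => f w - f' w) (fun w => g w - g' w).
Proof.
move=> fg fg'; apply: same_cexpD => //.
apply: (same_cexp_pull_bounded mH fg' (k := cst (-1))) => //.
- by move=> t; rewrite normrN1.
- by move=> w; rewrite mulN1r.
- by move=> w; rewrite mulN1r.
Qed.

End linear.

Lemma measurable_from_bool d (T : measurableType d) (f : bool -> T) :
  measurable_fun setT f.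
Proof. by []. Qed.

Lemma measurable_bool_set d (T : measurableType d) (b : T -> bool) :
  measurable_fun setT b -> measurable [set w | b w].
Proof.
move=> mb; rewrite (_ : [set w | b w] = b @^-1` [set true]).
  by rewrite -[X in measurable X]setTI; exact: mb.
by [].
Qed.

Section charged_bool.
Context d dU dX (T : measurableType d) (TU : measurableType dU)
  (TX : measurableType dX) (R : realType).
Variables (P : probability T R) (A : T -> bool) (U : T -> TU) (X : T -> TX).
Hypotheses (mA : measurable_fun setT A) (mU : measurable_fun setT U)
  (mX : measurable_fun setT X).

(** A set [B] of values of [(A, U, X)] is cut into its sections [Ba a]. Each section pulls back to a
    null event because [b] with [A = a] is charged along [(U, X)], and the two pullbacks cover that
    of [B]. *)
Lemma charged_pair_bool (b : T -> bool) : measurable_fun setT b ->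
  (forall a, charged P (fun w => (U w, X w)) [set w | b w && (A w == a)]) ->
  charged P (fun w => (A w, U w, X w)) [set w | b w].
Proof.
move=> mb cb B mB B0.
pose Ba a : set (TU * TX) := (fun v => (a, v.1, v.2)) @^-1` B.
have mV : measurable_fun setT (fun w => (U w, X w)) by exact: measurable_fun_pair.
have mG : measurable_fun setT (fun w => (A w, U w, X w)).
  by apply: measurable_fun_pair => //; exact: measurable_fun_pair.
have mBa a : measurable (Ba a).
  rewrite -[X in measurable X]setTI; apply: (_ : measurable_fun setT _) => //.
  apply: measurable_fun_pair; last exact: measurable_snd.
  by apply: measurable_fun_pair; [exact: measurable_cst|exact: measurable_fst].
have Ba0 a : P ((fun w => (U w, X w)) @^-1` Ba a) = 0%E.
  apply: (cb a) => //; apply: (subset_measure0 _ _ _ B0).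
  - apply: measurableI; last exact: measurable_preimage.
    apply: measurable_bool_set; apply: measurable_and => //.
    exact: (measurableT_comp (measurable_from_bool (fun c => c == a)) mA).
  - apply: measurableI; last exact: measurable_preimage.
    exact: measurable_bool_set.
  - by move=> w [/= /andP[bw /eqP <-]].
apply: (@subset_measure0 _ _ _ _ _ ((fun w => (U w, X w)) @^-1` Ba true `|`
  (fun w => (U w, X w)) @^-1` Ba false)).
- exact: measurable_preimage.
- by apply: measurableU; exact: (measurable_preimage mV).
- by move=> w; rewrite /Ba /=; case: (A w); [left|right].
- by apply: null_set_setU; try exact: Ba0; exact: (measurable_preimage mV).
Qed.

End charged_bool.

(** * The selection model *)

Section measurable_coordinates.
Context d d1 d2 (T : measurableType d) (T1 : measurableType d1)
  (T2 : measurableType d2).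

Lemma measurable_fun_fst (f : T -> T1 * T2) : measurable_fun setT f ->
  measurable_fun setT (fun x => (f x).1).
Proof. exact: (measurableT_comp measurable_fst). Qed.

Lemma measurable_fun_snd (f : T -> T1 * T2) : measurable_fun setT f ->
  measurable_fun setT (fun x => (f x).2).
Proof. exact: (measurableT_comp measurable_snd). Qed.

Lemma measurable_fun_of_bool (g : bool -> T1) (f : T -> bool) :
  measurable_fun setT f -> measurable_fun setT (fun x => g (f x)).
Proof. exact: (measurableT_comp (measurable_from_bool g)). Qed.

End measurable_coordinates.

Section model.
Context d dU dX dZ dW (T : measurableType d) (TU : measurableType dU)
  (TX : measurableType dX) (TZ : measurableType dZ) (TW : measurableType dW)
  (R : realType).
Variables (P : probability T R) (A Y S : T -> bool)
  (U : T -> TU) (X : T -> TX) (Z : T -> TZ) (W : T -> TW).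
Hypotheses (mA : measurable_fun setT A) (mY : measurable_fun setT Y)
  (mS : measurable_fun setT S) (mU : measurable_fun setT U)
  (mX : measurable_fun setT X) (mZ : measurable_fun setT Z)
  (mW : measurable_fun setT W).

Let V w := (U w, X w).
Let G w := (A w, U w, X w).
Let K w := (U w, X w, Y w, S w).

Hypothesis pos : forall a y : bool,
  charged P V [set w | [&& A w == a, Y w == y & S w]].

Variables (beta0 : R) (eta xi : TU * TX -> R).
Hypotheses (meta : measurable_fun setT eta) (mxi : measurable_fun setT xi).

Let mV : measurable_fun setT V.
Proof. exact: measurable_fun_pair. Qed.

Let mG : measurable_fun setT G.
Proof. by apply: measurable_fun_pair => //; exact: measurable_fun_pair. Qed.

Let mK : measurable_fun setT K.
Proof. by do 2 (apply: measurable_fun_pair => //). Qed.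

Let mAa (a : bool) : measurable_fun setT (fun w => A w == a).
Proof. exact: (measurableT_comp (measurable_from_bool (fun c => c == a)) mA). Qed.

Let mYy (y : bool) : measurable_fun setT (fun w => Y w == y).
Proof. exact: (measurableT_comp (measurable_from_bool (fun c => c == y)) mY). Qed.

Let mnY : measurable_fun setT (fun w => ~~ Y w).
Proof. exact: (measurableT_comp (measurable_from_bool negb) mY). Qed.

Let mnat (b : T -> bool) : measurable_fun setT b ->
  measurable_fun setT (fun w => (b w)%:R : R).
Proof. by move=> mb; apply: measurable_bool_natr; exact: measurable_bool_set. Qed.

Let mevent (a y : bool) : measurable [set w | [&& A w == a, Y w == y & S w]].
Proof. by apply: measurable_bool_set; do 2 (apply: measurable_and => //). Qed.

Let charged_event (a y : bool) (b : T -> bool) : measurable_fun setT b ->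
  (forall w, A w = a -> Y w = y -> S w -> b w) -> charged P V [set w | b w].
Proof.
move=> mb sub; apply: (charged_sub mV (mevent a y)) => //.
  exact: measurable_bool_set.
by move=> w /= /and3P[/eqP Aa /eqP Yy Sw]; exact: sub.
Qed.

Let charged_G (b : T -> bool) y : measurable_fun setT b ->
  (forall w, Y w = y -> S w -> b w) -> charged P G [set w | b w].
Proof.
move=> mb sub; apply: charged_pair_bool => // a.
apply: (@charged_event a y) => [|w Aa Yy Sw]; first exact: measurable_and.
by rewrite sub // Aa eqxx.
Qed.

(** The odds of [Y = 1] given [A = a] and [V = v] in the odds ratio model. *)
Let odds (a : bool) v : R := expR (beta0 * a%:R + eta v).

Let modds a : measurable_fun setT (odds a).
Proof.
apply: (measurableT_comp (@measurable_expR R)).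
by apply: measurable_funD => //; exact: measurable_cst.
Qed.

Let oddsG (g : bool * TU * TX) : R := odds g.1.1 (g.1.2, g.2).

Let moddsG : measurable_fun setT oddsG.
Proof.
apply: (measurableT_comp (@measurable_expR R)).
apply: measurable_funD.
  apply: measurable_funM => //.
  exact: (measurableT_comp (measurable_from_bool (fun c : bool => c%:R : R))
    (measurableT_comp measurable_fst measurable_fst)).
apply: (measurableT_comp meta); apply: measurable_fun_pair => //.
exact: (measurableT_comp measurable_snd measurable_fst).
Qed.

Let G_V (f g : T -> R) : same_cexp P G f g -> same_cexp P V f g.
Proof.
apply: (same_cexp_comp (k := fun g => (g.1.2, g.2))).
apply: measurable_fun_pair => //.
exact: (measurableT_comp measurable_snd measurable_fst).
Qed.

Let at_a (a : bool) (f g : T -> R) : same_cexp P G f g ->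
  same_cexp P G (fun w => (A w == a)%:R * f w) (fun w => (A w == a)%:R * g w).
Proof.
move=> fg; apply: (same_cexp_pull_bounded mG fg (k := fun g => (g.1.1 == a)%:R)) => //.
- exact: (measurableT_comp (measurable_from_bool (fun c => (c == a)%:R : R))
    (measurableT_comp measurable_fst measurable_fst)).
- by move=> t; case: eqP; rewrite ?normr1 ?normr0.
Qed.

Hypothesis odds_ratio_model : {ae P, forall w,
  logit (cond_prob P G [set w | Y w] w) = beta0 * (A w)%:R + eta (V w)}.

(** By positivity [p = P(Y = 1 | A, V)] lies strictly between 0 and 1, so the logit inverts to
    [p = odds (1 - p)]. Then [p] and [1 - p] are exchanged for the indicators of [Y = 1] and
    [Y = 0], and the relation is restricted to [A = a] and coarsened to [V]. *)
Lemma odds_identity a : same_cexp P V (fun w => (A w == a)%:R * (Y w)%:R)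
  (fun w => (A w == a)%:R * (~~ Y w)%:R * odds a (V w)).
Proof.
have mYs := measurable_bool_set mY; have mnYs := measurable_bool_set mnY.
have [p [mp Yp pae]] := cond_exp_ae mG (integrable_indic P mYs).
have {}Yp : same_cexp P G (fun w => (Y w)%:R) (fun w => p (G w)).
  by apply: (same_cexp_eq Yp) => // w; rewrite bool_indicE.
have nYp : same_cexp P G (fun w => (~~ Y w)%:R) (fun w => 1 - p (G w)).
  have i1 : P.-integrable setT (EFin \o (cst 1 : T -> R)).
    exact: finite_measure_integrable_cst.
  apply: (same_cexp_eq (same_cexpB mG (same_cexp_refl G i1) Yp)) => // w.
  by case: (Y w); rewrite ?subrr ?subr0.
have p0 : {ae P, forall w, 0 < p (G w)}.
  apply: (charged_gt0 mG (b := xpredT) (b' := Y)) => //.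
    by apply: (@charged_G _ true).
  by apply: (same_cexp_eq Yp) => w //; rewrite mul1r.
have p1 : {ae P, forall w, 0 < 1 - p (G w)}.
  apply: (charged_gt0 mG (b := xpredT) (b' := fun w => ~~ Y w) (m := fun g => 1 - p g)) => //.
  - exact: measurable_funB.
  - by apply: (@charged_G _ false) => // w ->.
  - by apply: (same_cexp_eq nYp) => w //; rewrite mul1r.
have pE : {ae P, forall w, p (G w) = oddsG (G w) * (1 - p (G w))}.
  have := odds_ratio_model; move: pae; rewrite /cond_prob.
  move=> pae oae; have : {ae P, forall w, logit (p (G w)) = beta0 * (A w)%:R + eta (V w)}.
    by move: pae oae; apply: filterS2 => w /= ->.
  move: p0 p1; apply: filterS3 => w /= p0 p1; rewrite /logit /oddsG /odds /= => <-.
  by rewrite lnK ?posrE ?divr_gt0 // divfK // gt_eqF.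
have [_ pi _] := Yp; have [_ npi _] := nYp.
have s1 : same_cexp P G (fun w => (Y w)%:R) (fun w => oddsG (G w) * (1 - p (G w))).
  apply: same_cexp_trans Yp _; apply: same_cexp_ae => //.
  apply: measurable_funM; last exact: integrable_measurable npi.
  exact: (measurableT_comp moddsG mG).
have s2 : same_cexp P G (fun w => oddsG (G w) * (1 - p (G w)))
    (fun w => oddsG (G w) * (~~ Y w)%:R).
  apply: (same_cexp_pull mG (same_cexp_sym nYp) moddsG (m := cst 1)
    (D := fun w => (~~ Y w)%:R)) => //.
  - by move=> w; rewrite mulr1.
  - by case: s1.
have /(at_a a)/G_V := same_cexp_trans s1 s2.
move=> h; apply: (same_cexp_eq h) => // w; rewrite /oddsG /=.
by case: eqP => [->|_]; rewrite ?mul0r // -mulrA; congr (_ * _); exact: mulrC.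
Qed.

Hypothesis xi_gt0 : forall v, 0 < xi v.
Hypothesis selection : forall a : bool, {ae P, forall w,
  cond_prob (cond_law P [set w | Y w && (A w == a)]) V [set w | S w] w /
  cond_prob (cond_law P [set w | ~~ Y w && (A w == a)]) V [set w | S w] w = xi (V w)}.

(** The odds of [Y = 1] given [V = v] among the selected with [A = a]. *)
Let r (a : bool) v : R := xi v * odds a v.

Let mr a : measurable_fun setT (r a).
Proof. exact: measurable_funM. Qed.

(** Bayes' rule in product form. With [s1], [s0] the selection probabilities for [Y = 1] and
    [Y = 0], on [A = a]: [S Y] becomes [s1 Y = xi s0 Y], then [xi s0 odds (1 - Y)], then
    [xi odds S (1 - Y)]. *)
Lemma selected_odds_identity a :
  same_cexp P V (fun w => (S w)%:R * (A w == a)%:R * (Y w)%:R)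
    (fun w => (S w)%:R * (A w == a)%:R * (~~ Y w)%:R * r a (V w)).
Proof.
have mSs := measurable_bool_set mS.
have mI : measurable_fun setT (\1_[set w | S w] : T -> R) by exact: measurable_indic.
have sel (b : T -> bool) y : measurable_fun setT b ->
    (forall w, A w = a -> Y w = y -> S w -> b w) ->
    exists m : TU * TX -> R, [/\ measurable_fun setT m,
      same_cexp P V (fun w => (b w)%:R * (S w)%:R) (fun w => (b w)%:R * m (V w)) &
      {ae P, forall w, cond_prob (cond_law P [set w | b w]) V [set w | S w] w = m (V w)}].
  move=> mb sub; have mbs := measurable_bool_set mb.
  have ib : P.-integrable setT (EFin \o (fun w => (b w)%:R * \1_[set w | S w] w)).
    apply: (integrable_le (integrable_bool P mbs)).
      by apply: measurable_funM => //; exact: measurable_bool_natr.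
    by move=> w; rewrite normrM ler_piMr // normr_indic_le1.
  have [m [mm s ae]] := cond_exp_cond_law mV mbs mI ib (charged_event mb sub).
  by exists m; split => //; apply: (same_cexp_eq s) => // w; rewrite -[in RHS]bool_indicE.
have mb1 : measurable_fun setT (fun w => Y w && (A w == a)) by exact: measurable_and.
have mb0 : measurable_fun setT (fun w => ~~ Y w && (A w == a)) by exact: measurable_and.
have [|s1 [ms1 E1 ae1]] := sel _ true mb1; first by move=> w -> ->; rewrite eqxx.
have [|s0 [ms0 E0 ae0]] := sel _ false mb0; first by move=> w -> ->; rewrite eqxx.
have s10 : {ae P, forall w, s1 (V w) = xi (V w) * s0 (V w)}.
  move: ae1 ae0 (selection a); apply: filterS3 => w /= -> -> e.
  (* Division by 0 gives 0, so [s0 = 0] would make the ratio 0, against [xi > 0]. *)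
  have s00 : s0 (V w) != 0.
    by apply/eqP => s00; have := xi_gt0 (V w); rewrite -e s00 invr0 mulr0 ltxx.
  by rewrite -e divfK.
have [i1S i1 _] := E1; have [_ i0 _] := E0.
have mxs : measurable_fun setT (fun v => xi v * s0 v) by exact: measurable_funM.
have mxV k : measurable_fun setT k -> measurable_fun setT (fun w => k (V w) : R).
  by move=> mk; exact: measurableT_comp.
have t1 : same_cexp P V (fun w => (Y w && (A w == a))%:R * s1 (V w))
    (fun w => (xi (V w) * s0 (V w)) * ((A w == a)%:R * (Y w)%:R)).
  apply: same_cexp_ae => //.
    apply: measurable_funM; first exact: (mxV _ mxs).
    by apply: measurable_funM; apply: mnat.
  move: s10; apply: filterS => w ->.
  by case: (Y w); case: (A w == a); rewrite /=; ring.
have [_ t1i _] := t1.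
have t2 := same_cexp_pull mV (odds_identity a) mxs (modds a)
  (D := fun w => (A w == a)%:R * (~~ Y w)%:R) (fun=> mulr_ge0 (ler0n _ _) (ler0n _ _))
  (fun=> erefl) (fun=> erefl) (fun=> erefl) t1i.
have t3 : same_cexp P V
    (fun w => (xi (V w) * s0 (V w)) * ((A w == a)%:R * (~~ Y w)%:R * odds a (V w)))
    (fun w => r a (V w) * ((~~ Y w && (A w == a))%:R * (S w)%:R)).
  apply: (same_cexp_pull mV (same_cexp_sym E0) (mr a) (m := cst 1)
    (D := fun w => (~~ Y w && (A w == a))%:R * (S w)%:R)) => //.
  - by move=> w; rewrite mulr1.
  - by move=> w; rewrite /r; case: (Y w); case: (A w == a); rewrite /=; ring.
  - by case: t2.
have t4 := same_cexp_trans (same_cexp_trans E1 t1) (same_cexp_trans t2 t3).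
apply: (same_cexp_eq t4) => w.
- by case: (Y w); case: (A w == a); case: (S w); rewrite /=; ring.
- by case: (Y w); case: (A w == a); case: (S w); rewrite /=; ring.
Qed.

(** * The integrand of [Theta_a] under either bridge assumption *)

Variables (q : bool * TZ * TX -> R) (h : bool * TW * TX -> R) (c : TX -> R).
Hypotheses (mq : measurable_fun setT q) (mh : measurable_fun setT h)
  (mc : measurable_fun setT c).

Let N w := (Y w, W w, S w).

Hypothesis int_q :
  P.-integrable setT (EFin \o (fun w => (S w)%:R * q (A w, Z w, X w))).
Hypothesis int_h : forall a : bool, P.-integrable setT
  (EFin \o (fun w => (S w)%:R * ((1 - (Y w)%:R) * h (a, W w, X w)))).
Hypothesis int_cqY : forall a : bool, P.-integrable setT
  (EFin \o (fun w => (S w)%:R *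
    (c (X w) * (A w == a)%:R * q (A w, Z w, X w) * (Y w)%:R))).
Hypothesis int_cqh : forall a : bool, P.-integrable setT
  (EFin \o (fun w => (S w)%:R * (c (X w) * (A w == a)%:R * q (A w, Z w, X w) *
                           (1 - (Y w)%:R) * h (a, W w, X w)))).
Hypothesis int_ch : forall a : bool, P.-integrable setT
  (EFin \o (fun w => (S w)%:R * (c (X w) * (1 - (Y w)%:R) * h (a, W w, X w)))).
Hypothesis indep_W : cond_indep P W A K.
Hypothesis indep_Z : cond_indep P Z N G.

Ltac meas := repeat first [ assumption | exact: measurable_id | exact: measurable_cst
  | exact: measurable_fst | exact: measurable_snd
  | apply: measurable_funM | apply: measurable_funB | apply: (measurableT_comp mc)
  | apply: (measurableT_comp mq) | apply: (measurableT_comp mh)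
  | apply: measurable_fun_pair | apply: measurable_and
  | apply: measurable_fun_fst | apply: measurable_fun_snd
  | apply: (measurable_fun_of_bool negb)
  | apply: (measurable_fun_of_bool (fun b => b == _))
  | apply: (measurable_fun_of_bool (fun b : bool => b%:R : R))
  | apply: (measurable_fun_of_bool (fun b : bool => (b == _)%:R : R))
  | apply: (measurable_fun_of_bool (fun b : bool => (~~ b)%:R : R)) ].

Let mN : measurable_fun setT N.
Proof. by rewrite /N; meas. Qed.

Let Da (a : bool) w := (A w == a) && S w.
Let D0 w := ~~ Y w && S w.
Let Da0 (a : bool) w := [&& A w == a, ~~ Y w & S w].

Let mDa (a : bool) : measurable_fun setT (Da a).
Proof. by rewrite /Da; meas. Qed.

Let mD0 : measurable_fun setT D0.
Proof. by rewrite /D0; meas. Qed.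

Let mDa0 (a : bool) : measurable_fun setT (Da0 a).
Proof. by rewrite /Da0; meas. Qed.

Let indep_Z_on (a : bool) : cond_indep_on P (Da a) Z N G.
Proof.
apply: (cond_indep_on_restrict (D := fun p : (bool * TW * bool) * (bool * TU * TX) =>
    (p.2.1.1 == a) && p.1.2) mN mG).
  by apply: measurable_bool_set; meas.
exact: cond_indep_cond_indep_on.
Qed.

(** With [A] as the first variable, this replaces the indicator of [A = a] in front of functions of
    [W]; through [cond_indep_on_integrable] it also averages functions of [W] given [(A, K)]. *)
Let indep_W_on : cond_indep_on P D0 A W K.
Proof.
apply: (cond_indep_on_restrict (D := fun p : TW * (TU * TX * bool * bool) =>
    ~~ p.2.1.2 && p.2.2) mW mK).
  by apply: measurable_bool_set; meas.
by apply: cond_indep_cond_indep_on => //; exact: cond_indep_sym.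
Qed.

Let K_V (f g : T -> R) : same_cexp P K f g -> same_cexp P V f g.
Proof. by apply: (same_cexp_comp (k := fun g => g.1.1)); meas. Qed.

Let NG_V (f g : T -> R) : same_cexp P (fun w => (N w, G w)) f g -> same_cexp P V f g.
Proof. by move=> /same_cexp_snd/G_V. Qed.

Let WK_V (f g : T -> R) : same_cexp P (fun w => (W w, K w)) f g -> same_cexp P V f g.
Proof. by move=> /same_cexp_snd/K_V. Qed.

Let charged_Da0 (a : bool) : charged P V [set w | Da0 a w].
Proof. by apply: (@charged_event a false) => // w; rewrite /Da0 => -> -> ->; rewrite eqxx. Qed.

Let charged_D0 : charged P V [set w | D0 w].
Proof. by apply: (@charged_event true false) => // w _; rewrite /D0 => -> ->. Qed.

Let charged_Da (a : bool) : charged P V [set w | Da a w].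
Proof. by apply: (@charged_event a false) => // w; rewrite /Da => -> _ ->; rewrite eqxx. Qed.

Let theta (a : bool) w : R := c (X w) * ((A w == a)%:R * q (A w, Z w, X w) *
  ((Y w)%:R - (1 - (Y w)%:R) * h (a, W w, X w)) + (1 - (Y w)%:R) * h (a, W w, X w)).

(** The integrand splits into terms supported on [Y = 1] ([odd_part]) and on [Y = 0] (the other
    two). Each is integrable by assumption, so it can be transformed on its own. *)
Let odd_part (a : bool) w : R :=
  (S w)%:R * (c (X w) * (A w == a)%:R * q (A w, Z w, X w) * (Y w)%:R).
Let even_part (a : bool) w : R := (S w)%:R * (c (X w) * (A w == a)%:R *
  q (A w, Z w, X w) * (1 - (Y w)%:R) * h (a, W w, X w)).
Let plug_in (a : bool) w : R := (S w)%:R * (c (X w) * (1 - (Y w)%:R) * h (a, W w, X w)).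

Let thetaE (a : bool) w : (S w)%:R * theta a w = odd_part a w - even_part a w + plug_in a w.
Proof. by rewrite /theta /odd_part /even_part /plug_in; ring. Qed.

(** The bridge reads [t p = 1], where [t] averages [q] on [Da0 a] and [p] is the probability of
    [A = a] on [D0], both given [V]. It relates [odd_part] to [D0 c r_a], and [even_part] to
    [plug_in], so these two cancel. *)
Lemma theta_treatment_bridge :
  (forall a : bool, {ae P, forall w,
     cond_exp (cond_law P [set w | [&& A w == a, ~~ Y w & S w]]) V
       (fun w => q (A w, Z w, X w)) w =
     1 / cond_prob (cond_law P [set w | ~~ Y w && S w]) V [set w | A w == a] w}) ->
  forall a : bool, same_cexp P V (fun w => (S w)%:R * theta a w)
    (fun w => (D0 w)%:R * (c (X w) * r a (V w))).
Proof.
move=> bridge a.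
have mfq : measurable_fun setT (fun w => q (A w, Z w, X w)) by meas.
have iq (b : T -> bool) : measurable_fun setT b -> (forall w, b w -> S w) ->
    P.-integrable setT (EFin \o (fun w => (b w)%:R * q (A w, Z w, X w))).
  move=> mb bS; apply: (integrable_le int_q); first by meas.
  move=> w; case bw: (b w); last by rewrite mul0r normr0.
  by rewrite (bS _ bw).
have [t [mt Et aet]] := cond_exp_cond_law mV (measurable_bool_set (mDa0 a)) mfq
  (iq _ (mDa0 a) (fun w bw => proj2 (andP (proj2 (andP bw))))) (@charged_Da0 a).
have mIA : measurable_fun setT (\1_[set w | A w == a] : T -> R).
  by apply: measurable_indic; exact: measurable_bool_set.
have iA : P.-integrable setT (EFin \o (fun w => (D0 w)%:R * \1_[set w | A w == a] w)).
  apply: (integrable_le (integrable_bool P (measurable_bool_set mD0))).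
    by apply: measurable_funM => //; exact: mnat.
  by move=> w; rewrite normrM ler_piMr // normr_indic_le1.
have [p [mp Ep aep]] := cond_exp_cond_law mV (measurable_bool_set mD0) mIA iA charged_D0.
have {}Ep : same_cexp P V (fun w => (D0 w)%:R * (A w == a)%:R)
    (fun w => (D0 w)%:R * p (V w)).
  apply: (same_cexp_eq Ep) => // w.
  by rewrite -[in RHS](bool_indicE R (fun w => A w == a)).
have p_gt0 : {ae P, forall w, 0 < p (V w)}.
  apply: (charged_gt0 mV (b := D0) (b' := fun w => A w == a)) => //.
  - by apply: measurable_bool_set; meas.
  - apply: (@charged_event a false); first by meas.
    by move=> w; rewrite /D0 => -> -> ->; rewrite eqxx.
  - by apply: (same_cexp_eq Ep) => // w; case: (D0 w); rewrite ?mul1r ?mul0r.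
(* Since [1 / 0] is 0 by convention, [p > 0] is what turns the bridge into a product. *)
have tp : {ae P, forall w, t (V w) * p (V w) = 1}.
  have := bridge a; rewrite /cond_prob => br.
  have {}br : {ae P, forall w, t (V w) = 1 / p (V w)}.
    by move: aet aep br; apply: filterS3 => w /= -> ->.
  move: p_gt0 br; apply: filterS2 => w /= p0 ->.
  by rewrite divfK // gt_eqF.
(* [t'] averages [q] on [A = a, S = 1] given [G], without fixing [Y]. By the independence of [Z] it
   still does given [(N, G)]. *)
have [t' mt' Et'] := same_cexp_exists_on mG (measurable_bool_set (mDa a))
  (charged_neq0 (@charged_Da a)) mfq (iq _ (mDa a) (fun w bw => proj2 (andP bw))).
have E5 := cond_indep_on_integrable (phi := fun p => q (p.2.1.1, p.1, p.2.2))
  mN mZ mG (measurable_bool_set (mDa a)) ltac:(by meas) mt' (fun=> erefl)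
  (cond_indep_on_sym mZ mN mG (measurable_bool_set (mDa a))
    (charged_neq0 (@charged_Da a)) (@indep_Z_on a)) Et'.
have mNG := measurable_fun_pair mN mG.
(* Restricted to [Y = 0], an event of [N], the average [t'] is that of the bridge; agreement on the
   charged event [Da0 a] gives agreement almost surely. *)
have t't : {ae P, forall w, t' (a, U w, X w) = t (V w)}.
  have s1 : same_cexp P V (fun w => (Da0 a w)%:R * q (A w, Z w, X w))
      (fun w => (Da0 a w)%:R * t' (a, U w, X w)).
    apply: NG_V; apply: (same_cexp_pull_bounded mNG E5 (k := fun p => (~~ p.1.1.1)%:R)).
    - by meas.
    - by move=> p'; case: (~~ _); rewrite ?normr1 ?normr0.
    - move=> w; rewrite /Da /Da0 /=.
      by case: (A w == a); case: (Y w); case: (S w); rewrite /=; ring.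
    - move=> w; rewrite /Da /Da0 /= /G; case: eqP => [->|_]; last by rewrite /= !mul0r mulr0.
      by case: (Y w); case: (S w); rewrite /=; ring.
  apply: (charged_ae_eq mV (b := Da0 a) (m := fun v => t' (a, v.1, v.2))) => //.
  - exact: measurable_bool_set.
  - by apply: (measurableT_comp mt'); meas.
  apply: (same_cexp_uniq mV (m := fun v => t' (a, v.1, v.2)) _ mt) => //.
    by apply: (measurableT_comp mt'); meas.
  exact: same_cexp_trans (same_cexp_sym s1) Et.
have mtV : measurable_fun setT (fun w => t (V w)) by exact: measurableT_comp.
have mpV : measurable_fun setT (fun w => p (V w)) by exact: measurableT_comp.
have mrV : measurable_fun setT (fun w => r a (V w)).
  by apply: (measurableT_comp (mr a)).
have E7 : same_cexp P (fun w => (N w, G w))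
    (fun w => (Da a w)%:R * q (A w, Z w, X w)) (fun w => (Da a w)%:R * t (V w)).
  apply: (same_cexp_trans E5); apply: same_cexp_ae => //; first by case: E5.
    by apply: measurable_funM => //; exact: mnat.
  move: t't; apply: filterS => w <-; rewrite /Da /G.
  by case: eqP => [->//|_]; rewrite !mul0r.
(* For [odd_part] four replacements follow: [q] by [t], [Y] by [(1 - Y) r_a], the indicator of
   [A = a] by [p], and [t p] by 1. *)
have s1 : same_cexp P (fun w => (N w, G w)) (odd_part a)
    (fun w => (c (X w) * (Y w)%:R) * ((Da a w)%:R * t (V w))).
  apply: (same_cexp_pull mNG E7 (k := fun p => c p.2.2 * (p.1.1.1)%:R)
    (m := fun p => t (p.2.1.2, p.2.2)) (D := fun w => (Da a w)%:R)) => //.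
  - by meas.
  - by apply: (measurableT_comp mt); meas.
  - move=> w; rewrite /odd_part /Da /=.
    by case: (A w == a); case: (S w); rewrite /=; ring.
  - exact: int_cqY.
have [_ i1 _] := s1.
have s2 : same_cexp P V (fun w => (c (X w) * (Y w)%:R) * ((Da a w)%:R * t (V w)))
    (fun w => (c (X w) * t (V w)) *
      ((S w)%:R * (A w == a)%:R * (~~ Y w)%:R * r a (V w))).
  apply: (same_cexp_pull mV (selected_odds_identity a) (k := fun v => c v.2 * t v)
    (m := r a) (D := fun w => (S w)%:R * (A w == a)%:R * (~~ Y w)%:R)) => //.
  - by meas.
  - move=> w; rewrite /Da /=.
    by case: (A w == a); case: (S w); rewrite /=; ring.
have [_ i2 _] := s2.
have s3 : same_cexp P V
    (fun w => (c (X w) * t (V w)) *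
      ((S w)%:R * (A w == a)%:R * (~~ Y w)%:R * r a (V w)))
    (fun w => (c (X w) * t (V w) * r a (V w)) * ((D0 w)%:R * p (V w))).
  apply: (same_cexp_pull mV Ep (k := fun v => c v.2 * t v * r a v)
    (m := p) (D := fun w => (D0 w)%:R)) => //.
  - by apply: measurable_funM => //; meas.
  - move=> w; rewrite /D0 /=.
    by case: (A w == a); case: (S w); case: (Y w); rewrite /=; ring.
have [_ i3 _] := s3.
have s4 : same_cexp P V
    (fun w => (c (X w) * t (V w) * r a (V w)) * ((D0 w)%:R * p (V w)))
    (fun w => (D0 w)%:R * (c (X w) * r a (V w))).
  apply: same_cexp_ae => //.
    by apply: measurable_funM; [exact: mnat|meas].
  move: tp; apply: filterS => w e; rewrite -[RHS]mulr1 -e; ring.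
have mWK := measurable_fun_pair mW mK.
have ma : measurable [set a] by [].
have [k mk Ek] := indep_W_on ma.
have {}Ek : same_cexp P (fun w => (W w, K w)) (fun w => (D0 w)%:R * (A w == a)%:R)
    (fun w => (D0 w)%:R * k (K w)).
  apply: (same_cexp_eq Ek) => // w; rewrite indicE.
  by case: eqP => [->|n]; [rewrite mem_set|rewrite memNset].
(* On [D0] the value of [K] is [(V, false, true)], so [k] is a function of [V] there and uniqueness
   identifies it with [p]. *)
have kp : {ae P, forall w, k (V w, false, true) = p (V w)}.
  have mk' : measurable_fun setT (fun v => k (v, false, true)).
    by apply: (measurableT_comp mk); meas.
  apply: (charged_ae_eq mV (b := D0) (m := fun v => k (v, false, true))) => //.
    exact: measurable_bool_set.
  apply: (same_cexp_uniq mV mk' mp) => //.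
  apply: same_cexp_trans _ Ep; apply: same_cexp_sym.
  apply: (same_cexp_eq (WK_V Ek)) => // w; rewrite /D0 /K.
  by case: (Y w); case: (S w); rewrite /= ?mul0r.
have E8 : same_cexp P (fun w => (W w, K w)) (fun w => (D0 w)%:R * (A w == a)%:R)
    (fun w => (D0 w)%:R * p (V w)).
  apply: (same_cexp_trans Ek); apply: same_cexp_ae => //; first by case: Ek.
    by apply: measurable_funM => //; exact: mnat.
  move: kp; apply: filterS => w <-; rewrite /D0 /K.
  by case: (Y w); case: (S w); rewrite /= ?mul0r.
(* For [even_part], [q] becomes [t], then the indicator of [A = a] becomes [p] along [(W, K)], where
   [h(a, W, X)] is a known factor; [t p = 1] leaves [plug_in]. *)
have u1 : same_cexp P (fun w => (N w, G w)) (even_part a)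
    (fun w => (c (X w) * (~~ Y w)%:R * h (a, W w, X w)) * ((Da a w)%:R * t (V w))).
  apply: (same_cexp_pull mNG E7
    (k := fun p => c p.2.2 * (~~ p.1.1.1)%:R * h (a, p.1.1.2, p.2.2))
    (m := fun p => t (p.2.1.2, p.2.2)) (D := fun w => (Da a w)%:R)) => //.
  - by meas.
  - by apply: (measurableT_comp mt); meas.
  - move=> w; rewrite /even_part /Da /=.
    by case: (A w == a); case: (S w); case: (Y w); rewrite /=; ring.
  - exact: int_cqh.
have [_ j1 _] := u1.
have u2 : same_cexp P (fun w => (W w, K w))
    (fun w => (c (X w) * (~~ Y w)%:R * h (a, W w, X w)) * ((Da a w)%:R * t (V w)))
    (fun w => (c (X w) * t (V w) * h (a, W w, X w)) * ((D0 w)%:R * p (V w))).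
  apply: (same_cexp_pull (measurable_fun_pair mW mK) E8
    (k := fun p => c p.2.1.1.2 * t p.2.1.1 * h (a, p.1, p.2.1.1.2))
    (m := fun z => p z.2.1.1) (D := fun w => (D0 w)%:R)) => //.
  - apply: measurable_funM; last by meas.
    by apply: measurable_funM; [meas|apply: (measurableT_comp mt); meas].
  - by apply: (measurableT_comp mp); meas.
  - move=> w; rewrite /Da /D0 /=.
    by case: (A w == a); case: (S w); case: (Y w); rewrite /=; ring.
have [_ j2 _] := u2.
have u3 : same_cexp P V
    (fun w => (c (X w) * t (V w) * h (a, W w, X w)) * ((D0 w)%:R * p (V w)))
    (plug_in a).
  apply: same_cexp_ae => //; first by rewrite /plug_in; meas.
  move: tp; apply: filterS => w e; rewrite -[RHS]mulr1 -[X in _ = _ * X]e /plug_in /D0.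
  by case: (S w); case: (Y w); rewrite /=; ring.
have s := same_cexp_trans (NG_V s1) (same_cexp_trans s2 (same_cexp_trans s3 s4)).
have u := same_cexp_trans (NG_V u1) (same_cexp_trans (WK_V u2) u3).
apply: (same_cexp_eq (same_cexpD mV (same_cexpB mV s u) (same_cexp_refl V (int_ch a)))).
- exact: thetaE.
- by move=> w; rewrite /plug_in subrK.
Qed.

(* On the event A = a the sigma-algebras generated by (A, U, X) and by (U, X)
   have the same trace. *)
Let V_G (a : bool) (f g : T -> R) :
  (forall w, f w = (A w == a)%:R * f w) -> (forall w, g w = (A w == a)%:R * g w) ->
  same_cexp P V f g -> same_cexp P G f g.
Proof.
move=> fa ga [fi gi fg]; split => // B mB.
pose Ba : set (TU * TX) := (fun v => (a, v.1, v.2)) @^-1` B.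
have mBa : measurable Ba.
  by rewrite -[X in measurable X]setTI; apply: (_ : measurable_fun setT _) => //; meas.
have E (k : T -> R) : (forall w, k w = (A w == a)%:R * k w) ->
    (\int[P]_(w in G @^-1` B) (k w)%:E = \int[P]_(w in V @^-1` Ba) (k w)%:E)%E.
  move=> ka; rewrite !integral_preimage_indic //; apply: eq_integral => w _.
  congr _%:E; rewrite ka /Ba !indicE /G /V.
  case: eqP => [->|_]; last by rewrite mul0r !mulr0.
  by congr (_%:R * _); rewrite !in_setE.
by rewrite !E // fg.
Qed.

(** Once the bridge ratio is identified with [r_a] ([ma_r]), [plug_in] alone is related to
    [D0 c r_a] ([F3]) and the other two terms together to 0 ([F5]). *)
Lemma theta_outcome_bridge :
  {ae P, forall w,
     cond_exp (cond_law P [set w | ~~ Y w && S w]) G (fun w => h (A w, W w, X w)) w =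
     cond_prob (cond_law P [set w | S w]) G [set w | Y w] w /
     cond_prob (cond_law P [set w | S w]) G [set w | ~~ Y w] w} ->
  forall a : bool, same_cexp P V (fun w => (S w)%:R * theta a w)
    (fun w => (D0 w)%:R * (c (X w) * r a (V w))).
Proof.
move=> bridge a.
have mSs := measurable_bool_set mS.
have mWK := measurable_fun_pair mW mK.
have mha b : measurable_fun setT (fun w => h (b, W w, X w)) by meas.
have mhA : measurable_fun setT (fun w => h (A w, W w, X w)) by meas.
have mrV : measurable_fun setT (fun w => r a (V w)).
  by apply: (measurableT_comp (mr a)).
have iha b : P.-integrable setT (EFin \o (fun w => (D0 w)%:R * h (b, W w, X w))).
  apply: (integrable_ext (int_h b)) => w; rewrite /D0.
  by case: (Y w); case: (S w); rewrite /=; ring.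
have ihA : P.-integrable setT (EFin \o (fun w => (D0 w)%:R * h (A w, W w, X w))).
  (* Integrability is assumed at each fixed [a]; [h] at the random [A] is dominated by the sum over
     both values. *)
  apply: (integrable_le (integrable_add (integrable_norm (iha true))
    (integrable_norm (iha false)))); first by meas; exact: mnat.
  move=> w; apply: (le_trans _ (ler_norm _)).
  by case: (A w) => /=; rewrite ?lerDl ?lerDr normr_ge0.
have cG0 : charged P G [set w | D0 w].
  have sub w : Y w = false -> S w -> D0 w by rewrite /D0 => -> ->.
  exact: (@charged_G _ false mD0 sub).
have cGS : charged P G [set w | S w] by exact: (@charged_G _ false mS (fun w _ Sw => Sw)).
have [m [mm Em aem]] := cond_exp_cond_law mG (measurable_bool_set mD0) mhA ihA cG0.
have outcome (b : T -> bool) : measurable_fun setT b -> exists y : bool * TU * TX -> R,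
    [/\ measurable_fun setT y,
    same_cexp P G (fun w => (S w)%:R * (b w)%:R) (fun w => (S w)%:R * y (G w)) &
    {ae P, forall w, cond_prob (cond_law P [set w | S w]) G [set w | b w] w = y (G w)}].
  move=> mb; have mI : measurable_fun setT (\1_[set w | b w] : T -> R).
    by apply: measurable_indic; exact: measurable_bool_set.
  have iI : P.-integrable setT (EFin \o (fun w => (S w)%:R * \1_[set w | b w] w)).
    apply: (integrable_le (integrable_bool P mSs)).
      by apply: measurable_funM => //; exact: mnat.
    by move=> w; rewrite normrM ler_piMr // normr_indic_le1.
  have [y [my Ey aey]] := cond_exp_cond_law mG mSs mI iI cGS.
  by exists y; split => //; apply: (same_cexp_eq Ey) => // w; rewrite -[in RHS](bool_indicE R b).
have [y1 [my1 E1 ae1]] := outcome _ mY.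
have [y0 [my0 E0 ae0]] := outcome _ mnY.
have y0_gt0 : {ae P, forall w, 0 < y0 (G w)}.
  apply: (charged_gt0 mG (b := S) (b' := fun w => ~~ Y w)) => //.
  - by apply: measurable_bool_set; meas.
  - apply: (@charged_G _ false); first by meas.
    by move=> w -> ->.
  - by apply: (same_cexp_eq E0) => // w; case: (S w); rewrite ?mul1r ?mul0r.
have y1E : {ae P, forall w, y1 (G w) = m (G w) * y0 (G w)}.
  have ratio : {ae P, forall w, m (G w) = y1 (G w) / y0 (G w)}.
    have e : {ae P, forall w, m (G w) =
        cond_prob (cond_law P [set w | S w]) G [set w | Y w] w /
        cond_prob (cond_law P [set w | S w]) G [set w | ~~ Y w] w}.
      by move: aem bridge; apply: filterS2 => w /= ->.
    by move: ae1 ae0 e; apply: filterS3 => w /= -> ->.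
  move: y0_gt0 ratio; apply: filterS2 => w y0w ->.
  by rewrite divfK // gt_eqF.
have myG (y : bool * TU * TX -> R) : measurable_fun setT y ->
    measurable_fun setT (fun w => y (G w)).
  by move=> my; exact: measurableT_comp.
have [_ i1 _] := E1; have [_ i0 _] := E0.
have e1 : same_cexp P G (fun w => (S w)%:R * (Y w)%:R)
    (fun w => m (G w) * ((S w)%:R * y0 (G w))).
  apply: (same_cexp_trans E1); apply: same_cexp_ae => //.
    by apply: measurable_funM; [exact: myG|exact: integrable_measurable i0].
  by move: y1E; apply: filterS => w ->; rewrite mulrCA.
have e2 : same_cexp P G (fun w => m (G w) * ((S w)%:R * y0 (G w)))
    (fun w => m (G w) * ((S w)%:R * (~~ Y w)%:R)).
  apply: (same_cexp_pull mG (same_cexp_sym E0) mm (m := cst 1)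
    (D := fun w => (S w)%:R * (~~ Y w)%:R)) => //.
  - by move=> w; rewrite mulr1.
  - by case: e1.
have mma : measurable_fun setT (fun v => m (a, v.1, v.2)).
  by apply: (measurableT_comp mm); meas.
(* On [A = a, S = 1] both [m] and [r_a] convert the indicator of [Y = 0] into that of [Y = 1], so
   they agree on a charged event. *)
have ma_r : {ae P, forall w, m (a, U w, X w) = r a (V w)}.
  apply: (charged_ae_eq mV (b := Da0 a) (m := fun v => m (a, v.1, v.2))) => //.
    exact: measurable_bool_set.
  apply: (same_cexp_uniq mV (m := fun v => m (a, v.1, v.2)) mma (mr a)) => //.
  have e3 := G_V (@at_a a _ _ (same_cexp_trans e1 e2)).
  apply: (@same_cexp_trans _ _ _ _ _ _ _ (fun w => (S w)%:R * (A w == a)%:R * (Y w)%:R)).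
    apply: same_cexp_sym; apply: (same_cexp_eq e3) => w; first by ring.
    rewrite /Da0 /G; case: eqP => [->|_]; rewrite ?mul0r //=.
    by case: (Y w); case: (S w); rewrite /=; ring.
  apply: (same_cexp_eq (selected_odds_identity a)) => // w; rewrite /Da0.
  by case: (A w == a); case: (Y w); case: (S w); rewrite /=; ring.
have F1 : same_cexp P V (fun w => (Da0 a w)%:R * h (a, W w, X w))
    (fun w => (Da0 a w)%:R * r a (V w)).
  have e3 := G_V (@at_a a _ _ Em).
  have {}e3 : same_cexp P V (fun w => (Da0 a w)%:R * h (a, W w, X w))
      (fun w => (Da0 a w)%:R * m (a, U w, X w)).
    apply: (same_cexp_eq e3) => w; rewrite /Da0 /D0 ?/G; case: eqP => [->|_];
      by case: (Y w); case: (S w); rewrite /=; ring.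
  apply: (same_cexp_trans e3); apply: same_cexp_ae => //; first by case: e3.
    by apply: measurable_funM => //; exact: mnat.
  by move: ma_r; apply: filterS => w ->.
(* [n] averages [h(a, W, X)] given [K] on the whole of [D0]. By the independence of [W] and [A] it
   still does given [(A, K)], so restricting to [A = a] allows comparison with [F1]. *)
have [n mn En] := same_cexp_exists_on mK (measurable_bool_set mD0)
  (charged_neq0 charged_D0) (mha a) (iha a).
have mphi : measurable_fun setT
    (fun p : TW * (TU * TX * bool * bool) => h (a, p.1, p.2.1.1.2)) by meas.
have EAK := cond_indep_on_integrable mA mW mK (measurable_bool_set mD0) mphi mn
  (fun=> erefl) indep_W_on En.
have mnV : measurable_fun setT (fun v => n (v, false, true)).
  by apply: (measurableT_comp mn); meas.
have nr : {ae P, forall w, n (V w, false, true) = r a (V w)}.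
  apply: (charged_ae_eq mV (b := Da0 a) (m := fun v => n (v, false, true))) => //.
    exact: measurable_bool_set.
  apply: (same_cexp_uniq mV mnV (mr a)) => //.
  apply: same_cexp_trans _ F1; apply: same_cexp_sym.
  apply: K_V; apply: (@same_cexp_snd _ _ _ _ _ _ _ P A K).
  apply: (same_cexp_pull_bounded (measurable_fun_pair mA mK) EAK
    (k := fun p => (p.1 == a)%:R)).
  - by meas.
  - by move=> p; case: (p.1 == a); rewrite ?normr1 ?normr0.
  - move=> w; rewrite /Da0 /D0 /=.
    by case: (A w == a); case: (Y w); case: (S w); rewrite /=; ring.
  - move=> w; rewrite /Da0 /D0 /K /=.
    by case: (A w == a); case: (Y w); case: (S w); rewrite /=; ring.
have F2 : same_cexp P V (fun w => (D0 w)%:R * h (a, W w, X w))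
    (fun w => (D0 w)%:R * r a (V w)).
  have e3 : same_cexp P V (fun w => (D0 w)%:R * h (a, W w, X w))
      (fun w => (D0 w)%:R * n (V w, false, true)).
    apply: (same_cexp_eq (K_V En)) => // w; rewrite /D0 /K.
    by case: (Y w); case: (S w); rewrite /= ?mul0r.
  apply: (same_cexp_trans e3); apply: same_cexp_ae => //; first by case: e3.
    by apply: measurable_funM => //; exact: mnat.
  by move: nr; apply: filterS => w ->.
have F3 : same_cexp P V (plug_in a) (fun w => (D0 w)%:R * (c (X w) * r a (V w))).
  have e3 : same_cexp P V (plug_in a) (fun w => c (X w) * ((D0 w)%:R * r a (V w))).
    apply: (same_cexp_pull mV F2 (k := fun v => c v.2) (m := r a)
      (D := fun w => (D0 w)%:R)) => //.
    - by meas.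
    - move=> w; rewrite /plug_in /D0.
      by case: (Y w); case: (S w); rewrite /=; ring.
    - exact: int_ch.
  by apply: (same_cexp_eq e3) => // w; rewrite mulrCA.
(* On [A = a, S = 1] both [Y] and [(1 - Y) h(a, W, X)] average to [(1 - Y) r_a]. The zero is written
   as a function of [G] to fit [cond_indep_on_integrable]. *)
have F4 : same_cexp P G
    (fun w => (Da a w)%:R * ((Y w)%:R - (~~ Y w)%:R * h (a, W w, X w)))
    (fun w => (Da a w)%:R * cst 0 (G w)).
  apply: (@V_G a).
  - by move=> w; rewrite /Da; case: (A w == a); rewrite /= ?mul1r ?mul0r.
  - by move=> w; rewrite /= !mulr0.
  apply: (same_cexp_eq (same_cexpB mV (selected_odds_identity a) F1)) => w.
  - rewrite /Da /Da0.
    by case: (A w == a); case: (Y w); case: (S w); rewrite /=; ring.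
  - rewrite /Da /Da0 /=.
    by case: (A w == a); case: (Y w); case: (S w); rewrite /=; ring.
have mpsi : measurable_fun setT (fun p : (bool * TW * bool) * (bool * TU * TX) =>
    (p.1.1.1)%:R - (~~ p.1.1.1)%:R * h (a, p.1.1.2, p.2.2)) by meas.
have m0 : measurable_fun setT (cst 0 : bool * TU * TX -> R) by [].
(* The average stays 0 when [Z] is known as well, so the factor [c q], a function of [(Z, G)], can
   be multiplied in. *)
have EZG := cond_indep_on_integrable mZ mN mG (measurable_bool_set (@mDa a)) mpsi
  m0 (fun=> erefl) (@indep_Z_on a) F4.
have mZG := measurable_fun_pair mZ mG.
have F5 : same_cexp P V (fun w => odd_part a w - even_part a w) (cst 0).
  apply: G_V; apply: (@same_cexp_snd _ _ _ _ _ _ _ P Z G).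
  apply: (same_cexp_pull mZG EZG (k := fun p => c p.2.2 * q (p.2.1.1, p.1, p.2.2))
    (m := cst 0) (D := fun w => (Da a w)%:R)) => //.
  - by meas.
  - move=> w; rewrite /odd_part /even_part /Da /=.
    by case: (A w == a); case: (Y w); case: (S w); rewrite /=; ring.
  - by move=> w; rewrite /= !mulr0.
  - exact: (integrableB measurableT (int_cqY a) (int_cqh a)).
apply: (same_cexp_eq (same_cexpD mV F5 F3)).
- exact: thetaE.
- by move=> w; rewrite add0r.
Qed.

End model.

(** If [E] meets an event of sigma([G]) in a null set, then [P(E | G)] integrates to 0 over that
    event; being almost surely positive, it forces the event to be null. *)
Lemma charged_cond_prob d d' (T : measurableType d) (T' : measurableType d')
    (R : realType) (P : probability T R) (G : T -> T') (E : set T) :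
  measurable_fun setT G -> measurable E ->
  {ae P, forall w, 0 < cond_prob P G E w} -> charged P G E.
Proof.
move=> mG mE pos B mB EB0.
have [p [mp Ep ae]] := cond_exp_ae mG (integrable_indic P mE).
have p0 : {ae P, forall w, 0 < p (G w)}.
  by move: ae pos; apply: filterS2 => w /= <-.
have [_ pi _] := Ep.
have [_ _ pE] : same_cexp P G \1_E (fun w => `|p (G w)|).
  apply: same_cexp_trans Ep _; apply: same_cexp_ae => //.
    by apply: measurableT_comp => //; exact: measurableT_comp.
  by move: p0; apply: filterS => w /= pw; rewrite gtr0_norm.
have mGB := measurable_preimage mG mB.
have : (\int[P]_(w in G @^-1` B) `|(p (G w))%:E| = 0)%E.
  by rewrite /= -pE // integral_indic // EB0.
move=> /(ae_eq_integral_abs P mGB) ae0.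
have {}ae0 := ae0 ltac:(by apply: measurable_funTS; apply/measurable_EFinP;
  exact: measurableT_comp).
have [N [mN N0 sN]] : {ae P, forall w, ~ B (G w)}.
  move: p0 ae0; apply: filterS2 => w /= pw + Bw => /(_ Bw) [] p00.
  by rewrite p00 ltxx in pw.
by apply: (subset_measure0 mGB mN _ N0) => w Bw; apply: sN => /=; exact.
Qed.
Theorem theorem5 (R : realType) (d : measure_display) (Omega : measurableType d)
    (P : probability Omega R) (nX nU nZ nW : nat)
    (A Y S : {RV P >-> bool})
    (X : {RV P >-> nX.-tuple R}) (U : {RV P >-> nU.-tuple R})
    (Z : {RV P >-> nZ.-tuple R}) (W : {RV P >-> nW.-tuple R})
    (beta0 : R)
    (eta : nU.-tuple R * nX.-tuple R -> R)
    (xi : nU.-tuple R * nX.-tuple R -> R)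
    (q : bool * nZ.-tuple R * nX.-tuple R -> R)
    (h : bool * nW.-tuple R * nX.-tuple R -> R)
    (c : nX.-tuple R -> R)
    (PS := cond_law P [set w | S w])
    (* measurability of the functions involved *)
    (meas_eta : measurable_fun setT eta) (meas_xi : measurable_fun setT xi)
    (meas_q : measurable_fun setT q) (meas_h : measurable_fun setT h)
    (meas_c : measurable_fun setT c)
    (* positivity *)
    (positivity : forall a y : bool, {ae P, forall w,
      0 < cond_prob P (fun w => (U w, X w))
            [set w | [&& A w == a, Y w == y & S w]] w})
    (* integrability given S = 1 *)
    (int_q : PS.-integrable setT (EFin \o (fun w => q (A w, Z w, X w))))
    (int_h : forall a : bool, PS.-integrable setT
      (EFin \o (fun w => (1 - (Y w)%:R) * h (a, W w, X w))))
    (int_cqY : forall a : bool, PS.-integrable setT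
      (EFin \o (fun w =>
         c (X w) * (A w == a)%:R * q (A w, Z w, X w) * (Y w)%:R)))
    (int_cqh : forall a : bool, PS.-integrable setT
      (EFin \o (fun w => c (X w) * (A w == a)%:R * q (A w, Z w, X w) *
                           (1 - (Y w)%:R) * h (a, W w, X w))))
    (int_ch : forall a : bool, PS.-integrable setT
      (EFin \o (fun w => c (X w) * (1 - (Y w)%:R) * h (a, W w, X w))))
    (* homogeneous odds ratio model *)
    (odds_ratio_model : {ae P, forall w,
      logit (cond_prob P (fun w => (A w, U w, X w)) [set w | Y w] w) =
        beta0 * (A w)%:R + eta (U w, X w)})
    (* (1) *)
    (xi_gt0 : forall ux, 0 < xi ux)
    (selection : forall a : bool, {ae P, forall w,
      cond_prob (cond_law P [set w | Y w && (A w == a)])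
        (fun w => (U w, X w)) [set w | S w] w /
      cond_prob (cond_law P [set w | ~~ Y w && (A w == a)])
        (fun w => (U w, X w)) [set w | S w] w = xi (U w, X w)})
    (* (2) *)
    (indep_W : cond_indep P W A (fun w => (U w, X w, Y w, S w)))
    (indep_Z : cond_indep P Z (fun w => (Y w, W w, S w))
                 (fun w => (A w, U w, X w)))
    (* (i) or (ii) *)
    (bridge :
      (forall a : bool, {ae P, forall w,
         cond_exp (cond_law P [set w | [&& A w == a, ~~ Y w & S w]])
           (fun w => (U w, X w)) (fun w => q (A w, Z w, X w)) w =
         1 / cond_prob (cond_law P [set w | ~~ Y w && S w])
               (fun w => (U w, X w)) [set w | A w == a] w})
      \/
      {ae P, forall w,
         cond_exp (cond_law P [set w | ~~ Y w && S w])
           (fun w => (A w, U w, X w)) (fun w => h (A w, W w, X w)) w =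
         cond_prob PS (fun w => (A w, U w, X w)) [set w | Y w] w /
         cond_prob PS (fun w => (A w, U w, X w)) [set w | ~~ Y w] w})
    (sqint_c : (fun w => c (X w)) \in Lfun P 2%:E)
    (Theta_neq0 : forall a : bool,
      fine ('E_PS[fun w => (c (X w) *
        ((A w == a)%:R * q (A w, Z w, X w) *
            ((Y w)%:R - (1 - (Y w)%:R) * h (a, W w, X w))
         + (1 - (Y w)%:R) * h (a, W w, X w)))%R]%E) != 0) :
  beta0 = ln
    (fine ('E_PS[fun w => (c (X w) *
        ((A w == true)%:R * q (A w, Z w, X w) *
            ((Y w)%:R - (1 - (Y w)%:R) * h (A w, W w, X w))
         + (1 - (Y w)%:R) * h (true, W w, X w)))%R]%E)
     / fine ('E_PS[fun w => (c (X w) *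
        ((A w == false)%:R * q (A w, Z w, X w) *
            ((Y w)%:R - (1 - (Y w)%:R) * h (A w, W w, X w))
         + (1 - (Y w)%:R) * h (false, W w, X w)))%R]%E)).
Proof.
have mA : measurable_fun setT A by [].
have mY : measurable_fun setT Y by [].
have mS : measurable_fun setT S by [].
have mU : measurable_fun setT U by [].
have mX : measurable_fun setT X by [].
have mZ : measurable_fun setT Z by [].
have mW : measurable_fun setT W by [].
have mV : measurable_fun setT (fun w => (U w, X w)) by exact: measurable_fun_pair.
have mev (a y : bool) : measurable [set w | [&& A w == a, Y w == y & S w]].
  apply: measurable_bool_set; apply: measurable_and.
    exact: (measurable_fun_of_bool (fun b => b == a)).
  apply: measurable_and => //.
  exact: (measurable_fun_of_bool (fun b => b == y)).
have pos (a y : bool) := charged_cond_prob mV (mev a y) (@positivity a y).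
have mSs := measurable_bool_set mS.
have PS0 : P [set w | S w] != 0%E.
  apply: (@charged_neq0 _ _ _ _ _ P (fun w => (U w, X w))).
  apply: (charged_sub mV (mev true true) mSs) (pos true true).
  by move=> w /= /and3P[].
have toP (f : Omega -> R) : PS.-integrable setT (EFin \o f) ->
    P.-integrable setT (EFin \o (fun w => (S w)%:R * f w)).
  move=> fi; have mf := integrable_measurable fi.
  exact/(integrable_cond_law mSs PS0 mf).
(* Either bridge leads to the same right side, which is free of [q] and [h]. *)
have theta_r (a : bool) : same_cexp P (fun w => (U w, X w))
    (fun w => (S w)%:R * (c (X w) * ((A w == a)%:R * q (A w, Z w, X w) *
      ((Y w)%:R - (1 - (Y w)%:R) * h (a, W w, X w)) +
      (1 - (Y w)%:R) * h (a, W w, X w))))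
    (fun w => (~~ Y w && S w)%:R *
      (c (X w) * (xi (U w, X w) * expR (beta0 * a%:R + eta (U w, X w))))).
  case: bridge => bridge.
  - by apply: (@theta_treatment_bridge _ _ _ _ _ _ _ _ _ _ _ P A Y S U X Z W) => // *; exact: toP.
  - by apply: (@theta_outcome_bridge _ _ _ _ _ _ _ _ _ _ _ P A Y S U X Z W) => // *; exact: toP.
pose I (a : bool) := fine (\int[P]_w ((~~ Y w && S w)%:R *
  (c (X w) * (xi (U w, X w) * expR (beta0 * a%:R + eta (U w, X w)))))%:E)%E.
(* Testing the relation on the whole space and normalising by [P(S = 1)] evaluates [Theta_a]. *)
have ES (a : bool) : fine ('E_PS[fun w => (c (X w) *
        ((A w == a)%:R * q (A w, Z w, X w) *
            ((Y w)%:R - (1 - (Y w)%:R) * h (a, W w, X w))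
         + (1 - (Y w)%:R) * h (a, W w, X w)))%R]%E) = (fine (P [set w | S w]))^-1 * I a.
  have [ti _ tE] := theta_r a.
  rewrite expectation.unlock (integral_cond_law mSs PS0 _ ti) //.
    have := tE _ measurableT; rewrite preimage_setT => ->.
    by [].
  have mh a' : measurable_fun setT (fun w => h (a', W w, X w)).
    by apply: (measurableT_comp meas_h); do 2 (apply: measurable_fun_pair => //).
  have mq : measurable_fun setT (fun w => q (A w, Z w, X w)).
    by apply: (measurableT_comp meas_q); do 2 (apply: measurable_fun_pair => //).
  have mYr : measurable_fun setT (fun w => (Y w)%:R : R).
    exact: (measurable_fun_of_bool (fun b : bool => b%:R : R)).
  have mAr : measurable_fun setT (fun w => (A w == a)%:R : R).
    exact: (measurable_fun_of_bool (fun b : bool => (b == a)%:R : R)).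
  have mY1 : measurable_fun setT (fun w => 1 - (Y w)%:R : R) by exact: measurable_funB.
  apply: measurable_funM; first exact: measurableT_comp.
  apply: measurable_funD; last exact: measurable_funM.
  apply: measurable_funM; first exact: measurable_funM.
  by apply: measurable_funB => //; exact: measurable_funM.
(* Where [A = a], [h] at [A] is [h] at [a]; elsewhere the indicator kills the term. The integrands
   of the conclusion are thus those of [Theta_a]. *)
have hA (a : bool) : (fun w => (c (X w) *
        ((A w == a)%:R * q (A w, Z w, X w) *
            ((Y w)%:R - (1 - (Y w)%:R) * h (A w, W w, X w))
         + (1 - (Y w)%:R) * h (a, W w, X w)))%R) =
    (fun w => (c (X w) *
        ((A w == a)%:R * q (A w, Z w, X w) *
            ((Y w)%:R - (1 - (Y w)%:R) * h (a, W w, X w))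
         + (1 - (Y w)%:R) * h (a, W w, X w)))%R).
  by apply/funext => w; case: eqP => [->//|_]; rewrite !mul0r.
(* The odds at [a = 1] are pointwise [e^beta0] times those at [a = 0]. *)
have IE : I true = expR beta0 * I false.
  have [_ i0 _] := theta_r false.
  rewrite /I -[expR beta0]/(fine (expR beta0)%:E) -fineM //; last exact: integrable_fin_num.
  rewrite -integralZl //; congr fine; apply: eq_integral => w _.
  rewrite -EFinM /= mulr1 mulr0 add0r expRD; congr _%:E; ring.
(* The ratio is [e^beta0 Theta_0 / Theta_0], and [Theta_0] is nonzero. *)
have := Theta_neq0 false; rewrite !hA !ES IE => I0.
by rewrite mulrCA mulfK // expRK.
Qed.
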